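(* Let $n$ be a positive integer, $0<p\le 2$ and $0<\alpha\le 1$, and let $A$ be a (nonempty) compact subset of $\bigl(\ell_p^n\bigr)^\alpha$. Then $|A| < \infty$.
   Context: $\bigl(\ell_p^n\bigr)^\alpha$ denotes $\mathbb{R}^n$ with the metric $d(x,y)=\|x-y\|_p^{\alpha\min\{1,p\}}$, where $\|x\|_p = \bigl(\sum_{j=1}^n |x_j|^p\bigr)^{1/p}$. A metric space is positive definite if for each of its nonempty finite subsets $B$ the matrix $[e^{-d(x,y)}]_{x,y\in B}$ is positive definite; the spaces $\bigl(\ell_p^n\bigr)^\alpha$ with $0<p\le2$, $0<\alpha\le1$ are positive definite. The magnitude of a compact positive definite metric space $(A,d)$ is $|A| = \sup\{\mu(A)^2/Z_A(\mu,\mu) : \mu\in M(A),\ Z_A(\mu,\mu)\neq 0\}\in[1,\infty]$, where $M(A)$ is the space of finite signed Borel measures on $A$ and $Z_A(\mu,\nu)=\int_A\int_A e^{-d(x,y)}\,d\mu(x)\,d\nu(y)$. *)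

(* Defs.v *)
From HB Require Import structures.
From mathcomp Require Import all_boot all_order all_algebra.
From mathcomp Require Import all_classical all_reals all_analysis.
From mathcomp Require Import ring.

Set Implicit Arguments.
Unset Strict Implicit.
Unset Printing Implicit Defensive.

Import Order.TTheory GRing.Theory Num.Theory.
Import numFieldNormedType.Exports.

Local Open Scope classical_set_scope.
Local Open Scope ring_scope.

(* The library's σ-algebras live on pointed types, hence this join. *)
#[short(type="pmetricType")]
HB.structure Definition PointedMetric (R : numDomainType) :=
  { X of Metric R X & Pointed X }.

(* The underlying type, topology and pseudometric are those of the library's
   subtype [set_type A]; [A0] is only there to supply a distinguished point. *)
Definition metric_subspace (R : realType) (X : metricType R) (A : set X)
  (A0 : A !=set0) : Type := set_type A.

Section metric_subspace.
Context (R : realType) (X : metricType R) (A : set X) (A0 : A !=set0).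
Local Notation S := (metric_subspace A0).

HB.instance Definition _ := PseudoMetric.copy S (set_type A).

Let dist (x y : S) : R := mdist (set_val x) (set_val y).

Let dist_ge0 (x y : S) : 0 <= dist x y. Proof. exact: mdist_ge0. Qed.

Let dist_positivity (x y : S) : dist x y = 0 -> x = y.
Proof. by move=> /mdist_positivity; rewrite set_valE; exact: val_inj. Qed.

Let ballE (x : S) (e : R) : ball x e = [set y | dist x y < e].
Proof.
by rewrite -[LHS]/(set_val @^-1` ball (set_val x) e) ballEmdist.
Qed.

HB.instance Definition _ :=
  PseudoMetric_isMetric.Build R S dist_ge0 dist_positivity ballE.

Let subspace_point : S :=
  exist (fun x => x \in A) (sval (cid A0)) (mem_set (svalP (cid A0))).

HB.instance Definition _ := isPointed.Build S subspace_point.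

End metric_subspace.

Section signed_integral.
Context d (T : measurableType d) (R : realType).
Implicit Types (mu : {charge set T -> \bar R}) (f : T -> R).

Definition hahn_pos mu : set T := sval (cid (Hahn_decomposition mu)).

Definition hahn_neg mu : set T :=
  sval (cid (svalP (cid (Hahn_decomposition mu)))).

Definition hahn_pos_neg mu : hahn_decomposition mu (hahn_pos mu) (hahn_neg mu)
  := svalP (cid (svalP (cid (Hahn_decomposition mu)))).

(* The measures mu+ and mu- of the Jordan decomposition do not depend on the
   chosen Hahn decomposition (lemma Hahn_decomposition_uniq). *)
Definition signed_integral mu f : R :=
  \int[jordan_pos (hahn_pos_neg mu)]_x f x -
  \int[jordan_neg (hahn_pos_neg mu)]_x f x.

End signed_integral.

Section magnitude.
Context (R : realType) (X : pmetricType R).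

(* M(X): a charge is a countably additive set function with finite values. *)
Definition signed_borel_measure : Type :=
  {charge set (g_sigma_algebraType (@open X)) -> \bar R}.

Definition Zform (mu nu : signed_borel_measure) : R :=
  signed_integral nu (fun y =>
    signed_integral mu (fun x => expR (- mdist (x : X) (y : X)))).

(* Defined for every [X]; it is the magnitude when X is compact and positive
   definite, where every integral above is finite and Z(mu, mu) >= 0. *)
Definition magnitude : \bar R :=
  ereal_sup [set ((fine (mu setT)) ^+ 2 / Zform mu mu)%:E |
             mu in [set mu : signed_borel_measure | Zform mu mu != 0]].

End magnitude.

Section powR_sums.
Context (R : realType).
Implicit Types (x y p a r : R).

Lemma powR_subadditive x y r : 0 <= x -> 0 <= y -> 0 < r -> r <= 1 ->
  (x + y) `^ r <= x `^ r + y `^ r.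
Proof.
move=> x0 y0 r0 r1.
have [->|xn0] := eqVneq x 0; first by rewrite powR0 ?gt_eqF// !add0r.
have [->|yn0] := eqVneq y 0; first by rewrite (powR0 (x := r)) ?gt_eqF// !addr0.
have xp : 0 < x by rewrite lt_neqAle eq_sym xn0.
have yp : 0 < y by rewrite lt_neqAle eq_sym yn0.
set s := x + y; have sp : 0 < s by rewrite addr_gt0.
have H z : 0 < z -> z <= s -> z / s * s `^ r <= z `^ r.
  move=> z0 zs; have -> : z `^ r = (z / s) `^ r * s `^ r.
    rewrite -powRM ?divr_ge0 ?(ltW z0) ?(ltW sp)//.
    by rewrite divfK// gt_eqF.
  rewrite ler_wpM2r ?powR_ge0// ger1_powR// divr_gt0//=.
  by rewrite ler_pdivrMr// mul1r.
apply: le_trans (lerD (H _ xp _) (H _ yp _)); rewrite ?lerDl ?lerDr//.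
by rewrite -mulrDl -mulrDl divff ?mul1r// lt0r_neq0.
Qed.

Lemma sum_powR_eq0 n p (f : 'I_n -> R) : 0 < p ->
  \sum_j `|f j| `^ p = 0 -> forall j, f j = 0.
Proof.
move=> p0 /eqP; rewrite psumr_eq0; last by move=> *; exact: powR_ge0.
by move=> /allP f0 j; have /f0 := mem_index_enum j; rewrite powR_eq0 normr_eq0
  => /andP[/eqP].
Qed.

Lemma minkowski_sum n p (f g : 'I_n -> R) : 1 <= p ->
  (\sum_j `|f j + g j| `^ p) `^ p^-1 <=
  (\sum_j `|f j| `^ p) `^ p^-1 + (\sum_j `|g j| `^ p) `^ p^-1.
Proof.
move=> p1; have p0 : 0 < p by rewrite (lt_le_trans _ p1).
set F := \sum_j `|f j| `^ p; set G := \sum_j `|g j| `^ p.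
have F0 : 0 <= F by apply: sumr_ge0 => *; exact: powR_ge0.
have G0 : 0 <= G by apply: sumr_ge0 => *; exact: powR_ge0.
have [F00|Fn0] := eqVneq F 0.
  have f0 := sum_powR_eq0 p0 F00.
  by under eq_bigr do rewrite f0 add0r; rewrite lerDr powR_ge0.
have [G00|Gn0] := eqVneq G 0.
  have g0 := sum_powR_eq0 p0 G00.
  by under eq_bigr do rewrite g0 addr0; rewrite lerDl powR_ge0.
set a := F `^ p^-1; set b := G `^ p^-1.
have ap : 0 < a by rewrite powR_gt0// lt_neqAle eq_sym Fn0.
have bp : 0 < b by rewrite powR_gt0// lt_neqAle eq_sym Gn0.
have aE : a `^ p = F by rewrite -powRrM mulVf ?gt_eqF// powRr1.
have bE : b `^ p = G by rewrite -powRrM mulVf ?gt_eqF// powRr1.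
clearbody a b.
have abp : 0 < a + b by rewrite addr_gt0.
suff H : \sum_j `|f j + g j| `^ p <= (a + b) `^ p.
  rewrite -[leRHS]powRr1 ?(ltW abp)// -[X in _ <= _ `^ X](@mulfV _ p) ?gt_eqF//.
  rewrite powRrM ge0_ler_powR ?invr_ge0 ?(ltW p0) ?nnegrE ?powR_ge0//.
  by apply: sumr_ge0 => *; exact: powR_ge0.
have t01 : 0 <= a / (a + b) <= 1.
  by rewrite divr_ge0 ?(ltW ap) ?(ltW abp)//= ler_pdivrMr// mul1r lerDl ltW.
have [t0 t1] := andP t01.
pose t : {i01 R} := Itv01 t0 t1.
have t'E : 1 - a / (a + b) = b / (a + b).
  by rewrite -[X in X - _](@divff _ (a + b)) ?gt_eqF// -mulrBl addrAC subrr add0r.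
have K j : `|f j + g j| `^ p <=
    (a + b) `^ p * (a / (a + b) * (`|f j| `^ p / F) +
                    b / (a + b) * (`|g j| `^ p / G)).
  have /(_ t (`|f j| / a) (`|g j| / b)) := @convex_powR R p p1.
  rewrite !inE/= !in_itv/= !andbT !divr_ge0 ?(ltW ap) ?(ltW bp)//.
  move=> /(_ isT isT) C.
  rewrite [X in X `^ _ <= _]convRE [X in _ <= X]convRE /= /unstable.onem t'E in C.
  rewrite -aE -bE.
  have D (x y : R) : 0 <= x -> 0 < y -> (x / y) `^ p = x `^ p / y `^ p.
    move=> x0 y0; rewrite powRM ?invr_ge0 ?(ltW y0)//; congr (_ * _).
    by rewrite -powRN -(powR_inv1 (ltW y0)) -powRrM mulN1r.
  rewrite !D// in C.
  apply: le_trans (ler_wpM2l (powR_ge0 _ _) C).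
  rewrite -powRM ?(ltW abp)//; last first.
    by rewrite addr_ge0// mulr_ge0// divr_ge0// ?(ltW abp) ?(ltW ap) ?(ltW bp).
  rewrite ge0_ler_powR ?(ltW p0) ?nnegrE//.
    by rewrite mulr_ge0 ?(ltW abp)// addr_ge0// mulr_ge0// divr_ge0//
      ?(ltW abp) ?(ltW ap) ?(ltW bp).
  apply: le_trans (ler_normD _ _) _.
  rewrite le_eqVlt; apply/orP; left; apply/eqP; field.
  by rewrite !gt_eqF.
apply: le_trans (ler_sum _ (fun j _ => K j)) _.
rewrite -mulr_sumr big_split/= -!mulr_sumr -!mulr_suml -/F -/G !divff// !mulr1.
by rewrite -mulrDl divff ?mulr1// gt_eqF.
Qed.

End powR_sums.

Section lp_metric.
Context (R : realType) (n : nat) (p a : R).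

Definition lpnorm (x : 'rV[R]_n) : R := (\sum_j `|x 0 j| `^ p) `^ p^-1.

Definition lpdist (x y : 'rV[R]_n) : R :=
  lpnorm (x - y) `^ (a * Num.min 1 p).

Hypotheses (p0 : 0 < p) (a0 : 0 < a) (a1 : a <= 1).

Let am0 : a * Num.min 1 p != 0.
Proof. by rewrite gt_eqF// mulr_gt0// lt_min ltr01. Qed.

Lemma lpdistxx x : lpdist x x = 0.
Proof.
rewrite /lpdist /lpnorm big1 => [|j _].
  by rewrite (@powR0 _ p^-1) ?powR0// gt_eqF// invr_gt0.
by rewrite subrr mxE normr0 powR0// gt_eqF.
Qed.

Lemma lpdist_positivity x y : lpdist x y = 0 -> x = y.
Proof.
move=> /powR_eq0_eq0/powR_eq0_eq0/(sum_powR_eq0 p0) xy.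
by apply/subr0_eq/rowP => j; rewrite xy mxE.
Qed.

Lemma lpdist_sym x y : lpdist x y = lpdist y x.
Proof.
rewrite /lpdist /lpnorm -[x - y]opprB.
by under eq_bigr do rewrite mxE normrN.
Qed.

Lemma lpdist_triangle y x z : lpdist x z <= lpdist x y + lpdist y z.
Proof.
pose m := Num.min 1 p; have m0 : 0 < m by rewrite lt_min ltr01.
suff H : lpnorm (x - z) `^ m <= lpnorm (x - y) `^ m + lpnorm (y - z) `^ m.
  have E u v : lpdist u v = (lpnorm (u - v) `^ m) `^ a.
    by rewrite -powRrM mulrC.
  rewrite !E.
  apply: le_trans (powR_subadditive _ _ a0 a1); rewrite ?powR_ge0//.
  by rewrite ge0_ler_powR ?nnegrE ?addr_ge0 ?powR_ge0 ?(ltW a0).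
have xyz j : (x - z) 0 j = (x - y) 0 j + (y - z) 0 j.
  by rewrite !mxE addrA subrK.
have L (b1 b2 c1 c2 d1 d2 : R) :
    b1 = b2 -> c1 = c2 -> d1 = d2 -> b2 <= c2 + d2 -> b1 <= c1 + d1.
  by move=> -> -> ->.
have [p1|p1] := leP 1 p.
  have E u : lpnorm u `^ m = lpnorm u.
    by rewrite /m (min_idPl p1) powRr1// powR_ge0.
  apply: (L _ _ _ _ _ _ (E _) (E _) (E _)); rewrite {1}/lpnorm.
  under eq_bigr do rewrite xyz.
  exact: minkowski_sum.
have E u : lpnorm u `^ m = \sum_j `|u 0 j| `^ p.
  rewrite /m (min_idPr (ltW p1)) /lpnorm -powRrM mulVf ?gt_eqF// powRr1//.
  by apply: sumr_ge0 => *; exact: powR_ge0.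
apply: (L _ _ _ _ _ _ (E _) (E _) (E _)).
rewrite -big_split/= ler_sum// => j _; rewrite xyz.
apply: le_trans (powR_subadditive _ _ p0 (ltW p1)); rewrite ?normr_ge0//.
by rewrite ge0_ler_powR ?nnegrE ?addr_ge0 ?normr_ge0 ?(ltW p0)// ler_normD.
Qed.

End lp_metric.

(* (ℓ_p^n)^α, with α written [a]. A new name for ['rV_n], so that its topology
   is the one induced by [lpdist]; the three hypotheses make it a metric. *)
Definition lpspace (R : realType) (n : nat) (p a : R)
  (p0 : 0 < p) (a0 : 0 < a) (a1 : a <= 1) : Type := 'rV[R]_n.

Section lpspace.
Context (R : realType) (n : nat) (p a : R).
Context (p0 : 0 < p) (a0 : 0 < a) (a1 : a <= 1).

HB.instance Definition _ := Choice.copy (lpspace n p0 a0 a1) 'rV[R]_n.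
HB.instance Definition _ := isMetric.Build R (lpspace n p0 a0 a1)
  (lpdistxx p0 a0) (lpdist_positivity p0)
  (@lpdist_sym R n p a) (lpdist_triangle p0 a0 a1).

End lpspace.

(* Main.v *)
Require Import Defs.
From mathcomp Require Import all_boot all_order all_algebra.
From mathcomp Require Import all_classical all_reals all_analysis.
From mathcomp Require Import measurable_realfun ring lra.

(** Magnitude is finite as soon as the kernel [expR (- d)] dominates a positive
constant kernel: if [expR (- d) - c] is positive semidefinite on [A], then
[c * mu(A)^2 <= Z(mu, mu)] for every signed measure [mu], hence
[|A| <= 1 / c]. For finitely supported [mu] this is the definition; a general
[mu] is concentrated on the centres of a partition of [A] into small Borel
cells, which changes [Z(mu, mu)] by little because [expR (- d)] is 1-Lipschitz
in each variable ([Zform_ge]).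

It is enough to find [c] such that [c - d] is positive semidefinite on [A]:
then [expR (- d) - expR (- c) = expR (- c) * (expR (c - d) - 1)], and the series
of [expR - 1] has nonnegative coefficients, so Schur's product theorem applies.
In the same way, if [c - s] is positive semidefinite for some [s] that is
nonnegative and vanishes on the diagonal, then so is [(2 c)^g - s^g] for
[0 < g <= 1], since [1 - (1 - u)^g] is a power series in [u] with nonnegative
coefficients ([psd_subr_powR]). As [d] is a power, with exponent at most 1, of
the sum of the [|x_j - y_j|^p], and of the Euclidean distance if [p = 2], it
remains to treat these two base kernels on bounded sets.

If [p < 2], each [|x_j - y_j|^p] can be treated alone, on a bounded interval
([psd_subr_dist_powR]). The mean of [|x + r U - y - r V|] over independent
uniform [U] and [V] is the integral over [z] of the probability that [z]
separates [x + r U] from [y + r V], so subtracting it from the length of an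
interval that contains these points leaves a positive semidefinite kernel. Up
to constants, [|x - y|^p] with [1 < p < 2] is a mixture of such means over the
scales [r <= 1] and one further scale. Letting [r] tend to 0 gives [|x - y|],
and then [p <= 1] by taking powers.

If [p = 2], no constant minus [|x_j - y_j|^2] is positive semidefinite, and the
Euclidean distance is treated directly ([psd_subr_l2dist]): it is proportional
to the mean of [|<x - y, u>|] over a standard normal vector [u], and for fixed
[u] this is the distance of two points of a bounded interval. *)

Import Order.TTheory GRing.Theory Num.Theory.
Import numFieldNormedType.Exports.
Local Open Scope classical_set_scope.
Local Open Scope ring_scope.

Set Implicit Arguments.
Unset Strict Implicit.
Unset Printing Implicit Defensive.

Lemma cvg_bigsum (R : realType) (U I : Type) (F : set_system U)
    {FF : Filter F} (s : seq I) (f : I -> U -> R) (l : I -> R) :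
  (forall i, f i u @[u --> F] --> l i) ->
  \sum_(i <- s) f i u @[u --> F] --> \sum_(i <- s) l i.
Proof.
move=> fl; elim: s => [|i s IH].
  by under eq_fun do rewrite big_nil; rewrite big_nil; exact: cvg_cst.
under eq_fun do rewrite big_cons; rewrite big_cons.
by apply: cvgD; [exact: fl|exact: IH].
Qed.

(** * Positive semidefinite kernels *)

Section PsdDef.
Context (R : realType) (T : Type).
Implicit Types (K : T -> T -> R) (f : T -> R).

Definition qform n (K : T -> T -> R) (x : 'I_n -> T) (c : 'I_n -> R) : R :=
  \sum_i \sum_j c i * c j * K (x i) (x j).

Definition psd K : Prop := (forall x y, K x y = K y x) /\
  forall n (x : 'I_n -> T) (c : 'I_n -> R), 0 <= qform K x c.

Lemma psd_ext K K' : (forall x y, K x y = K' x y) -> psd K -> psd K'.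
Proof.
move=> KK'; suff -> : K' = K by [].
by apply/funext => x; apply/funext => y; rewrite -KK'.
Qed.

Lemma psdD K K' : psd K -> psd K' -> psd (fun x y => K x y + K' x y).
Proof.
move=> [sK pK] [sK' pK']; split=> [x y|n x c]; first by rewrite sK sK'.
rewrite /qform; under eq_bigr do under eq_bigr do rewrite mulrDr.
under eq_bigr do rewrite big_split/=; rewrite big_split/= addr_ge0//;
  [exact: pK|exact: pK'].
Qed.

Lemma psdZ a K : 0 <= a -> psd K -> psd (fun x y => a * K x y).
Proof.
move=> a0 [sK pK]; split=> [x y|n x c]; first by rewrite sK.
rewrite /qform; under eq_bigr do under eq_bigr do rewrite mulrCA.
under eq_bigr do rewrite -mulr_sumr; rewrite -mulr_sumr mulr_ge0//.
exact: pK.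
Qed.

Lemma psd_rank1 f : psd (fun x y => f x * f y).
Proof.
split=> [x y|n x c]; first by rewrite mulrC.
rewrite /qform; under eq_bigr do under eq_bigr do rewrite mulrACA.
by under eq_bigr do rewrite -mulr_sumr; rewrite -mulr_suml -expr2 sqr_ge0.
Qed.

Lemma psd_cst a : 0 <= a -> psd (fun _ _ => a).
Proof.
move=> a0; apply: psd_ext (psdZ a0 (psd_rank1 (fun=> 1))) => x y.
by rewrite !mulr1.
Qed.

Lemma psd_sum (I : Type) (s : seq I) (K : I -> T -> T -> R) :
  (forall i, psd (K i)) -> psd (fun x y => \sum_(i <- s) K i x y).
Proof.
move=> pK; elim: s => [|i s IH].
  by apply: psd_ext (psd_cst (lexx 0)) => x y; rewrite big_nil.
by apply: psd_ext (psdD (pK i) IH) => x y; rewrite big_cons.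
Qed.

Lemma psd_lim (U : Type) (F : set_system U) {FF : ProperFilter F}
    (K : U -> T -> T -> R) K' :
  (\forall u \near F, psd (K u)) ->
  (forall x y, K u x y @[u --> F] --> K' x y) -> psd K'.
Proof.
move=> pK KK'; split=> [x y|n x c].
  have KK'' : K u x y @[u --> F] --> K' y x.
    apply: cvg_trans (KK' y x); apply: near_eq_cvg.
    by apply: filterS pK => u [sK _]; rewrite sK.
  exact: (cvg_unique _ (KK' x y) KK'').
have qK : qform (K u) x c @[u --> F] --> qform K' x c.
  apply: cvg_bigsum => i; apply: cvg_bigsum => j.
  by apply: cvgMl_tmp; exact: KK'.
by apply: (cvgr_to_ge qK); apply: filterS pK => u [_]; exact.
Qed.

Lemma psd_diag_ge0 K x : psd K -> 0 <= K x x.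
Proof.
move=> [_ /(_ 1%N (fun=> x) (fun=> 1))].
by rewrite /qform !big_ord1 !mul1r.
Qed.

Lemma psd2 K x y a b : psd K ->
  0 <= a ^+ 2 * K x x + 2 * a * b * K x y + b ^+ 2 * K y y.
Proof.
move=> [sK /(_ 2%N (fun i => if i == 0 then x else y)
                   (fun i => if i == 0 then a else b))].
rewrite /qform !big_ord_recl !big_ord0/= (sK y x) => h.
apply: le_trans h _; rewrite le_eqVlt; apply/orP; left; apply/eqP; ring.
Qed.

(** With [K x x = 0], the quadratic form at [x] and [y] is affine in the
coefficient at [x], so it can be nonnegative only if [K x y = 0]. *)
Lemma psd_diag0 K x y : psd K -> K x x = 0 -> K x y = 0.
Proof.
move=> pK Kxx; apply/eqP/negPn/negP => Kxy0.
have := psd2 x y (- (K y y + 1) / (2 * K x y)) 1 pK.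
rewrite Kxx mulr0 add0r expr1n mul1r mulr1.
have -> : 2 * (- (K y y + 1) / (2 * K x y)) * K x y = - (K y y + 1) by field.
by lra.
Qed.

End PsdDef.

Lemma psd_pullback (R : realType) (T S : Type) (h : T -> S)
    (K : S -> S -> R) : psd K -> psd (fun x y => K (h x) (h y)).
Proof. by move=> [sK pK]; split=> [x y|n x c]; [exact: sK|exact: pK]. Qed.

Section Schur.
Context (R : realType).

Lemma sum2_recl n (g : 'I_n.+1 -> 'I_n.+1 -> R) :
  \sum_i \sum_j g i j = g ord0 ord0 + \sum_j g ord0 (lift ord0 j) +
    (\sum_i g (lift ord0 i) ord0 +
     \sum_i \sum_j g (lift ord0 i) (lift ord0 j)).
Proof.
rewrite big_ord_recl big_ord_recl; congr (_ + _).
by under eq_bigr do rewrite big_ord_recl; rewrite big_split.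
Qed.

(** Schur's product theorem. The first kernel is reduced by Gaussian
elimination: subtracting the rank-one kernel supported by its first row leaves
a kernel that vanishes on that row and is still positive semidefinite on the
other points, while the product of a rank-one kernel with [N] is visibly
positive semidefinite. *)
Lemma schur_ord n (M N : 'I_n -> 'I_n -> R) (c : 'I_n -> R) :
  psd M -> psd N -> 0 <= \sum_i \sum_j c i * c j * (M i j * N i j).
Proof.
elim: n => [|n IH] in M N c *; first by rewrite big_ord0.
move=> pM pN; have sM := pM.1.
pose v i := M ord0 i; pose a := (M ord0 ord0)^-1.
have a0 : 0 <= a by rewrite invr_ge0; exact: psd_diag_ge0.
pose M' i j := M i j - a * (v i * v j).
have row0 j : M' ord0 j = 0.
  rewrite /M' /v /a; have [m0|m0] := eqVneq (M ord0 ord0) 0.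
    by rewrite (psd_diag0 _ pM)// mulr0 mulr0 subr0.
  by field.
have sM' i j : M' i j = M' j i by rewrite /M' sM (mulrC (v i)).
have -> : \sum_i \sum_j c i * c j * (M i j * N i j) =
    a * qform N id (fun i => c i * v i) +
    \sum_i \sum_j c (lift ord0 i) * c (lift ord0 j) *
      (M' (lift ord0 i) (lift ord0 j) * N (lift ord0 i) (lift ord0 j)).
  transitivity (a * qform N id (fun i => c i * v i) +
      \sum_i \sum_j c i * c j * (M' i j * N i j)).
    rewrite /qform mulr_sumr -big_split/=; apply: eq_bigr => i _.
    rewrite mulr_sumr -big_split/=; apply: eq_bigr => j _.
    by rewrite /M'; ring.
  congr (_ + _); rewrite big_ord_recl big1 ?add0r => [|j _]; last first.
    by rewrite row0 mul0r mulr0.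
  apply: eq_bigr => i _; rewrite big_ord_recl.
  by rewrite (sM' _ ord0) row0 mul0r mulr0 add0r.
rewrite addr_ge0//; first by rewrite mulr_ge0//; exact: pN.2.
apply: (IH (fun i j => M' (lift ord0 i) (lift ord0 j))
           (fun i j => N (lift ord0 i) (lift ord0 j))); last first.
  exact: (psd_pullback (lift ord0) pN).
split=> [i j|m x d]; first exact: sM'.
(* the coefficient at the first point that completes the square *)
pose e := - a * \sum_i d i * v (lift ord0 (x i)).
pose X i := oapp (lift ord0 \o x) ord0 (unlift ord0 i).
pose D i := oapp d e (unlift ord0 i).
have [X0 D0] : X ord0 = ord0 /\ D ord0 = e by rewrite /X /D unlift_none.
have XS j : X (lift ord0 j) = lift ord0 (x j) by rewrite /X liftK.
have DS j : D (lift ord0 j) = d j by rewrite /D liftK.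
have := pM.2 _ X D; rewrite /qform sum2_recl X0 D0.
pose S := \sum_i d i * v (lift ord0 (x i)).
have -> : \sum_j e * D (lift ord0 j) * M ord0 (X (lift ord0 j)) = e * S.
  by rewrite mulr_sumr; apply: eq_bigr => j _; rewrite XS DS -mulrA.
have -> : \sum_j D (lift ord0 j) * e * M (X (lift ord0 j)) ord0 = e * S.
  rewrite mulr_sumr; apply: eq_bigr => j _.
  by rewrite XS DS sM (mulrC (d j)) -mulrA.
have -> : \sum_i \sum_j D (lift ord0 i) * D (lift ord0 j) *
      M (X (lift ord0 i)) (X (lift ord0 j)) =
    \sum_i \sum_j d i * d j * M' (lift ord0 (x i)) (lift ord0 (x j)) + a * S ^+ 2.
  rewrite expr2 mulrA [a * S]mulr_sumr mulr_suml -big_split/=.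
  apply: eq_bigr => i _; rewrite mulr_sumr -big_split/=; apply: eq_bigr => j _.
  by rewrite !XS !DS /M'; ring.
set Q := \sum_i \sum_j _; move=> h; apply: le_trans h _.
rewrite le_eqVlt; apply/orP; left; apply/eqP.
rewrite -[M ord0 ord0]invrK -/a /e -/S.
have [->|a1] := eqVneq a 0; first by ring.
by field.
Qed.

End Schur.

Section PsdProducts.
Context (R : realType) (T : Type).
Implicit Types (K : T -> T -> R).

Lemma psdM K K' : psd K -> psd K' -> psd (fun x y => K x y * K' x y).
Proof.
move=> pK pK'; split=> [x y|n x c]; first by rewrite pK.1 pK'.1.
apply: (schur_ord (M := fun i j => K (x i) (x j))
                  (N := fun i j => K' (x i) (x j))).
- exact: (psd_pullback x pK).
- exact: (psd_pullback x pK').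
Qed.

Lemma psdX K n : psd K -> psd (fun x y => K x y ^+ n).
Proof.
move=> pK; elim: n => [|n IH]; first exact: psd_cst.
by apply: psd_ext (psdM pK IH) => x y; rewrite exprS.
Qed.

End PsdProducts.

(** * Series and integrals of kernels *)

Section PsdSeries.
Context (R : realType) (T : Type).
Implicit Types (K : T -> T -> R).

(** The exponential series has nonnegative coefficients; dropping its constant
term is what later leaves a positive constant below [expR (- d)]. *)
Lemma psd_expR_sub1 K : psd K -> psd (fun x y => expR (K x y) - 1).
Proof.
move=> pK.
apply: (psd_lim (F := \oo)
  (K := fun n x y => series (exp_coeff (K x y)) n.+1 - 1)); last first.
  move=> x y; apply: cvgB; last exact: cvg_cst.
  by rewrite cvg_shiftS; exact: is_cvg_series_exp_coeff.
apply: nearW => n.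
apply: (@psd_ext _ _ (fun x y => \sum_(i <- iota 1 n)
    i`!%:R^-1 * K x y ^+ i)).
  move=> x y; rewrite /series/= big_nat_recl// /exp_coeff/= expr0 fact0 divr1.
  rewrite addrC addKr -[iota 1 n]/(iota (1 + 0) n) iotaDl big_map /index_iota subn0.
  by apply: eq_bigr => i _; rewrite mulrC.
by apply: psd_sum => i; apply: psdZ; [rewrite invr_ge0|exact: psdX].
Qed.

Lemma psd_expR K : psd K -> psd (fun x y => expR (K x y)).
Proof.
move=> /psd_expR_sub1 pK.
apply: (@psd_ext _ _ (fun x y => expR (K x y) - 1 + 1)).
  by move=> x y; rewrite subrK.
by apply: psdD => //; exact: psd_cst.
Qed.

(** The geometric series. *)
Lemma psd_inv1B K : (forall x y, `|K x y| < 1) -> psd K ->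
  psd (fun x y => (1 - K x y)^-1).
Proof.
move=> K1 pK; apply: (psd_lim (F := \oo)
    (K := fun n x y => series (geometric 1 (K x y)) n)).
- apply: nearW => n; rewrite /series/=.
  apply: psd_sum => i; apply: (@psd_ext _ _ (fun x y => K x y ^+ i)).
    by move=> x y; rewrite mul1r.
  exact: psdX.
- move=> x y; rewrite -[X in _ --> X]mul1r; exact: cvg_geometric_series.
Qed.

End PsdSeries.

Section PsdIntegral.
Context d (U : measurableType d) (R : realType).
Context (mu : {measure set U -> \bar R}) (T : Type).

Lemma Rintegral_bigsum (I : Type) (s : seq I) (D : set U) (f : I -> U -> R) :
  measurable D -> (forall i, mu.-integrable D (EFin \o f i)) ->
  \int[mu]_(u in D) (\sum_(i <- s) f i u) =
  \sum_(i <- s) \int[mu]_(u in D) f i u /\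
  mu.-integrable D (EFin \o (fun u => \sum_(i <- s) f i u)).
Proof.
move=> mD fi; elim: s => [|i s [IH1 IH2]].
  under eq_Rintegral do rewrite big_nil.
  rewrite big_nil Rintegral_cst// mul0r; split=> //.
  under eq_fun do rewrite big_nil; exact: integrable0.
have E : (fun u => \sum_(j <- i :: s) f j u) =
         (fun u => f i u + \sum_(j <- s) f j u).
  by apply/funext => u; rewrite big_cons.
rewrite E big_cons RintegralD// IH1; split=> //.
exact: (integrableD mD (fi i) IH2).
Qed.

Lemma psd_Rintegral (D : set U) (K : U -> T -> T -> R) :
  measurable D -> (forall u, D u -> psd (K u)) ->
  (forall x y, mu.-integrable D (EFin \o (fun u => K u x y))) ->
  psd (fun x y => \int[mu]_(u in D) K u x y).
Proof.
move=> mD pK iK; split=> [x y|n x c].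
  by apply: eq_Rintegral => u /set_mem Du; rewrite (pK u Du).1.
have iK' i j : mu.-integrable D (EFin \o (fun u => c i * c j * K u (x i) (x j))).
  apply: (eq_integrable mD (fun u => (c i * c j)%:E * (K u (x i) (x j))%:E)%E) => //.
  by apply: integrableZl => //; exact: iK.
rewrite /qform; under eq_bigr do under eq_bigr do rewrite -RintegralZl//.
under eq_bigr do rewrite -(Rintegral_bigsum _ mD (iK' _)).1.
rewrite -(Rintegral_bigsum _ mD (fun i => (Rintegral_bigsum _ mD (iK' i)).2)).1.
by apply: Rintegral_ge0 => u Du; exact: (pK u Du).2.
Qed.

End PsdIntegral.

Section IntervalIntegrals.
Context (R : realType).
Notation mu := (@lebesgue_measure R).

Lemma integrable_cts (a b : R) (f : R -> R) :
  (forall x, x \in `[a, b] -> {for x, continuous f}) ->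
  mu.-integrable `[a, b] (EFin \o f).
Proof.
move=> cf; apply: continuous_compact_integrable; first exact: segment_compact.
apply: continuous_in_subspaceT => x /set_mem; exact: cf.
Qed.

(** Two-sided differentiability at the end points, which all the primitives
below have, implies the one-sided limits of the general theorem. *)
Lemma Rintegral_FTC (a b : R) (f F : R -> R) : a < b ->
  (forall x, x \in `[a, b] ->
     {for x, continuous f} /\ is_derive x 1 F (f x)) ->
  \int[mu]_(x in `[a, b]) f x = F b - F a.
Proof.
move=> ab cdF.
have cf x xab := (cdF x xab).1; have dF x xab := (cdF x xab).2.
rewrite /Rintegral (@continuous_FTC2 _ _ F)//.
- apply: continuous_in_subspaceT => x /set_mem; exact: cf.
- have cF x : x \in `[a, b] -> F y @[y --> x] --> F x.
    move=> xab; apply: differentiable_continuous; apply/derivable1_diffP.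
    by have [] := dF x xab.
  split=> [x /subset_itv_oo_cc xab||].
  + by have [] := dF x xab.
  + by apply: cvg_at_right_filter; apply: cF; rewrite bound_itvE ltW.
  + by apply: cvg_at_left_filter; apply: cF; rewrite bound_itvE ltW.
- move=> x /subset_itv_oo_cc xab; rewrite derive1E.
  by have [_ ->] := dF x xab.
Qed.

Lemma psd_Rintegral_itv (T : Type) (a b : R) (K : R -> T -> T -> R) :
  (forall u, u \in `[a, b] -> psd (K u)) ->
  (forall x y u, u \in `[a, b] -> {for u, continuous (fun v => K v x y)}) ->
  psd (fun x y => \int[mu]_(u in `[a, b]) K u x y).
Proof.
move=> pK cK; apply: psd_Rintegral => //; last first.
  by move=> x y; apply: integrable_cts => u; exact: cK.
Qed.

End IntervalIntegrals.

(** * Derivatives *)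

Section Derivatives.
Context (R : realType).
Implicit Types (f g : R -> R) (x a b : R).

Lemma der_cst c x : is_derive x (1 : R) (fun=> c : R) 0.
Proof. exact: is_derive_cst. Qed.

Lemma der_id x : is_derive x (1 : R) (fun y : R => y) 1.
Proof. exact: is_derive_id. Qed.

Lemma derD f g x a b : is_derive x 1 f a -> is_derive x 1 g b ->
  is_derive x 1 (fun y => f y + g y) (a + b).
Proof. exact: is_deriveD. Qed.

Lemma derN f x a : is_derive x 1 f a -> is_derive x 1 (fun y => - f y) (- a).
Proof. exact: is_deriveN. Qed.

Lemma derM f g x a b : is_derive x 1 f a -> is_derive x 1 g b ->
  is_derive x 1 (fun y => f y * g y) (f x * b + g x * a).
Proof. exact: is_deriveM. Qed.

Lemma derX f n x a : is_derive x 1 f a ->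
  is_derive x 1 (fun y => f y ^+ n) (n%:R * f x ^+ n.-1 * a).
Proof. 
move=> fa; have -> : (fun y => f y ^+ n) = f ^+ n.
  by apply/funext => y; elim: n => [|n IH]//; rewrite !exprS IH.
exact: is_deriveX.
Qed.

Lemma der_comp f g x a b : is_derive (g x) 1 f a -> is_derive x 1 g b ->
  is_derive x 1 (fun y => f (g y)) (a * b).
Proof. exact: is_derive1_comp. Qed.

Lemma der_continuous f x a : is_derive x 1 f a -> {for x, continuous f}.
Proof.
by move=> [df _]; apply: differentiable_continuous; apply/derivable1_diffP.
Qed.

Lemma der_aff (c t : R) : is_derive t 1 (fun s : R => 1 - s * c) (- c).
Proof.
apply: is_derive_eq (derD (der_cst _ _) (derN (derM (der_id _) (der_cst _ _)))) _.
by rewrite mulr0 mulr1 !add0r.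
Qed.

End Derivatives.

(** * Fractional powers *)

Lemma scale_lt1 (R : realType) (t w : R) :
  t \in `[0, 1] -> 0 <= w < 1 -> 0 <= t * w < 1.
Proof.
rewrite in_itv/= => /andP[t0 t1] /andP[w0 w1].
by rewrite mulr_ge0//= (le_lt_trans _ w1)// ler_piMl.
Qed.

Section PsdPowers.
Context (R : realType) (T : Type) (u : T -> T -> R).
Notation mu := (@lebesgue_measure R).
Hypotheses (u01 : forall x y, 0 <= u x y < 1) (pu : psd u).

Let theta_u t x y : t \in `[0, 1] -> 0 <= t * u x y < 1.
Proof. by move=> t01; exact: scale_lt1. Qed.

(** [- ln (1 - u)] is the integral of [u / (1 - t u)] over the unit interval, and
the integrand is a product of [u] with a geometric series in [u]. *)
Lemma psd_Nln1B : psd (fun x y => - ln (1 - u x y)).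
Proof.
apply: (@psd_ext _ _ (fun x y => \int[mu]_(t in `[0, 1])
    (u x y * (1 - t * u x y)^-1))).
  move=> x y.
  have aff_gt0 t : t \in `[0, 1] -> 0 < 1 - t * u x y.
    by move=> /(@theta_u _ x y)/andP[_ ?]; rewrite subr_gt0.
  rewrite (Rintegral_FTC (F := fun t => - ln (1 - t * u x y)))//.
    by rewrite mul1r mul0r subr0 ln1 oppr0 subr0.
  move=> t /aff_gt0 t01; split.
  - apply: cvgMl_tmp; apply: cvgV; first by rewrite gt_eqF.
    exact: der_continuous (der_aff _ _).
  - have D := derN (der_comp (g := fun s : R => 1 - s * u x y)
      (is_derive1_ln t01) (der_aff (u x y) t)).
    apply: (is_derive_eq D).
    by rewrite mulrN opprK mulrC.
apply: psd_Rintegral_itv => [t t01|x y t t01].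
  apply: psdM => //; apply: (psd_inv1B (K := fun x y => t * u x y)) => [x y|].
    by have /andP[h1 h2] := theta_u x y t01; rewrite ger0_norm.
  by apply: psdZ => //; move: t01; rewrite in_itv/= => /andP[].
have /andP[h1 h2] := theta_u x y t01.
apply: cvgMl_tmp; apply: cvgV; first by rewrite gt_eqF// subr_gt0.
exact: der_continuous (der_aff _ _).
Qed.

Lemma psd_powRN1B del : 0 <= del -> psd (fun x y => (1 - u x y) `^ (- del)).
Proof.
move=> del0; apply: psd_ext (psd_expR (psdZ del0 psd_Nln1B)) => x y.
have /andP[_ h] := u01 x y; rewrite /powR gt_eqF ?subr_gt0//.
by rewrite mulrN mulNr.
Qed.

End PsdPowers.

Section PsdPowers1.
Context (R : realType) (T : Type).
Notation mu := (@lebesgue_measure R).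

(** [1 - (1 - u) `^ g] is the integral of [g u (1 - t u) `^ (g - 1)], whose
exponent is nonpositive. *)
Lemma psd_1BpowR (u : T -> T -> R) g : (forall x y, 0 <= u x y < 1) -> psd u ->
  0 <= g <= 1 -> psd (fun x y => 1 - (1 - u x y) `^ g).
Proof.
move=> u01 pu /andP[g0 g1].
have tu t x y : t \in `[0, 1] -> 0 <= t * u x y < 1.
  by move=> t01; exact: scale_lt1.
have cont x y (t : R) : t \in `[0, 1] -> {for t, continuous (fun s : R =>
    g * (u x y * (1 - s * u x y) `^ (- (1 - g))))}.
  move=> t01; have /andP[h1 h2] := tu t x y t01.
  apply: cvgMl_tmp; apply: cvgMl_tmp.
  apply: (der_continuous (der_comp (g := fun s : R => 1 - s * u x y)
    (is_derive1_powR _ _) (der_aff _ _))).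
  by rewrite subr_gt0.
apply: (@psd_ext _ _ (fun x y => \int[mu]_(t in `[0, 1])
    (g * (u x y * (1 - t * u x y) `^ (- (1 - g)))))).
  move=> x y.
  rewrite (Rintegral_FTC (F := fun t => - (1 - t * u x y) `^ g))//.
    by rewrite mul1r mul0r subr0 powR1 opprK addrC.
  move=> t t01; split; first exact: cont.
  have /andP[h1 h2] := tu t x y t01.
  rewrite -subr_gt0 in h2.
  have D := derN (der_comp (g := fun s : R => 1 - s * u x y)
    (is_derive1_powR g h2) (der_aff (u x y) t)).
  apply: (is_derive_eq D).
  by rewrite opprB mulrN opprK mulrA mulrAC.
apply: psd_Rintegral_itv => [t t01|x y t t01]; last exact: cont.
apply: psdZ => //; apply: psdM => //.
apply: (@psd_powRN1B _ _ (fun x y => t * u x y)).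
- by move=> x y; exact: tu.
- by apply: psdZ => //; move: t01; rewrite in_itv/= => /andP[].
- by rewrite subr_ge0.
Qed.

(** [c - s] being positive semidefinite with [s] nonnegative and vanishing on
the diagonal makes [s] bounded by [2 c]; the previous lemma then applies to
[u = (2 c - s) / (2 c + e)], which is below 1 for [e > 0]. *)
Lemma psd_subr_powR (s : T -> T -> R) c g :
  (forall x y, 0 <= s x y) -> (forall x, s x x = 0) ->
  psd (fun x y => c - s x y) -> 0 < g <= 1 ->
  psd (fun x y => (2 * c) `^ g - s x y `^ g).
Proof.
move=> s0 s00 pcs /andP[g0 g1].
have s2c x y : s x y <= 2 * c.
  have := psd2 x y 1 1 pcs; rewrite !s00; lra.
have [c0|c0] := ltP c 0.
  split=> [x y|n x k]; first by have := s0 x y; have := s2c x y; lra.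
  rewrite /qform big1// => i _.
  by have := s0 (x i) (x i); have := s2c (x i) (x i); lra.
have pc2 : psd (fun x y => 2 * c - s x y).
  apply: (@psd_ext _ _ (fun x y => c - s x y + c)); first by move=> x y; ring.
  by apply: psdD => //; exact: psd_cst.
apply: (psd_lim (F := 0^'+)
    (K := fun e x y => (2 * c + e) `^ g - (s x y + e) `^ g)).
  near=> e; have e0 : 0 < e by [].
  have ce : 0 < 2 * c + e by lra.
  apply: (@psd_ext _ _ (fun x y => (2 * c + e) `^ g *
     (1 - (1 - (2 * c + e)^-1 * (2 * c - s x y)) `^ g))).
    move=> x y; have -> : 1 - (2 * c + e)^-1 * (2 * c - s x y) =
      (s x y + e) / (2 * c + e) by field; rewrite gt_eqF.
    rewrite mulrBr mulr1; congr (_ - _); rewrite -powRM ?(ltW ce)//.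
      by congr (_ `^ _); rewrite mulrC divfK// gt_eqF.
    by rewrite divr_ge0 ?(ltW ce)// addr_ge0// ltW.
  apply: psdZ; first exact: powR_ge0.
  apply: (psd_1BpowR (u := fun x y => (2 * c + e)^-1 * (2 * c - s x y))).
  - move=> x y; rewrite mulr_ge0 ?invr_ge0 ?(ltW ce) ?subr_ge0//=.
    by rewrite mulrC ltr_pdivrMr// mul1r; have := s0 x y; lra.
  - by apply: psdZ => //; rewrite invr_ge0 ltW.
  - by rewrite ltW.
move=> x y.
have H a : 0 <= a -> (a + e) `^ g @[e --> 0^'+] --> a `^ g.
  rewrite le_eqVlt => /orP[/eqP<-|a0].
    under eq_fun do rewrite add0r; rewrite powR0 ?gt_eqF//.
    exact: powR_cvg0.
  apply: cvg_at_right_filter.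
  rewrite -[X in _ --> X `^ _]addr0.
  apply: (der_continuous (der_comp (g := fun e : R => a + e) (is_derive1_powR _ _)
    (derD (der_cst _ _) (der_id _)))).
  by rewrite addr0.
by apply: cvgB; apply: H => //; rewrite mulr_ge0.
Unshelve. all: by end_near. Qed.

End PsdPowers1.

(** * Bounded subsets of the line *)

Section Glue.
Context (R : realType).

(** Used for functions given by different formulas on the two sides of [x],
and, with [F = G], for functions that agree with [F] near [x]. *)
Lemma der_glue (F G W : R -> R) (x d : R) :
  is_derive x 1 F d -> is_derive x 1 G d -> F x = W x -> G x = W x ->
  (\forall y \near x, W y = F y \/ W y = G y) -> is_derive x 1 W d.
Proof.
move=> [dF eF] [dG eG] Fx Gx FG.
suff H : h^-1 *: (W (h *: 1 + x) - W x) @[h --> 0^'] --> d.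
  apply: DeriveDef; first by apply/cvg_ex; exists d; exact: H.
  exact: (cvg_lim _ H).
have cF : h^-1 *: (F (h *: 1 + x) - F x) @[h --> 0^'] --> d by rewrite -eF; exact: dF.
have cG : h^-1 *: (G (h *: 1 + x) - G x) @[h --> 0^'] --> d by rewrite -eG; exact: dG.
apply/cvgrPdist_lt => e e0.
move/cvgrPdist_lt : cF => /(_ e e0) cF; move/cvgrPdist_lt : cG => /(_ e e0) cG.
have nW : \forall h \near 0^', W (h *: 1 + x) = F (h *: 1 + x) \/
    W (h *: 1 + x) = G (h *: 1 + x).
  have cx : h *: 1 + x @[h --> 0^'] --> x.
    rewrite -[X in _ --> X]add0r; apply: cvgD; last exact: cvg_cst.
    rewrite -[X in _ --> X](scale0r (1 : R)); apply: cvgZr_tmp.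
    by apply: cvg_within.
  exact: cx _ FG.
near=> h.
have [->|->] : W (h *: 1 + x) = F (h *: 1 + x) \/ W (h *: 1 + x) = G (h *: 1 + x).
  by near: h.
- by rewrite -Fx; near: h.
- by rewrite -Gx; near: h.
Unshelve. all: by end_near. Qed.

Definition pos_part (z : R) : R := Num.max 0 z.

Lemma der_pos_part_exp n x :
  is_derive x (1 : R) (fun z => pos_part z ^+ n.+2)
    (n.+2%:R * pos_part x ^+ n.+1).
Proof.
have dX (y : R) : is_derive y (1 : R) (fun z : R => z ^+ n.+2) (n.+2%:R * y ^+ n.+1).
  by have := derX n.+2 (der_id y); rewrite mulr1.
have [x0|x0|x0] := ltgtP x 0.
- apply: (der_glue (F := fun=> 0) (G := fun=> 0));
    rewrite /pos_part ?(max_idPl (ltW x0)) ?expr0n ?mulr0//.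
  + exact: der_cst.
  + exact: der_cst.
  + by near=> y; left; rewrite (max_idPl _) ?expr0n// ltW//; near: y; exact: lt_nbhsl.
- apply: (der_glue (F := fun z => z ^+ n.+2) (G := fun z => z ^+ n.+2));
    rewrite /pos_part ?(max_idPr (ltW x0))//.
  by near=> y; left; rewrite (max_idPr _)// ltW//; near: y; exact: lt_nbhsr.
- subst x; apply: (der_glue (F := fun z => 0) (G := fun z => z ^+ n.+2)).
  + by rewrite /pos_part maxxx expr0n mulr0; exact: der_cst.
  + by rewrite /pos_part maxxx; exact: dX.
  + by rewrite /pos_part maxxx expr0n.
  + by rewrite /pos_part maxxx.
  + near=> y; rewrite /pos_part; have [_|_] := leP 0 y; [right|left; rewrite expr0n].
Unshelve. all: by end_near. Qed.

End Glue.

Section Ramps.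
Context (R : realType).
Notation mu := (@lebesgue_measure R).

Definition pos_partM_primitive (a b z : R) : R :=
  - (pos_part (Num.min a b - z) ^+ 3 / 3 +
     (Num.max a b - Num.min a b) * pos_part (Num.min a b - z) ^+ 2 / 2).

(** Both sides vanish beyond [Num.min a b], so the product depends on [z] only
through one positive part. *)
Lemma pos_partM_minmax (a b z : R) : pos_part (a - z) * pos_part (b - z) =
  pos_part (Num.min a b - z) ^+ 2 +
  (Num.max a b - Num.min a b) * pos_part (Num.min a b - z).
Proof.
rewrite /pos_part; have [ab|ab] := leP a b.
  have [az|az] := leP 0 (a - z); have [bz|bz] := leP 0 (b - z).
  - ring.
  - lra.
  - ring.
  - ring.
have [az|az] := leP 0 (a - z); have [bz|bz] := leP 0 (b - z).
- ring.
- ring.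
- lra.
- ring.
Qed.

Let der_sub (m z : R) : is_derive z 1 (fun y : R => m - y) (-1).
Proof.
apply: is_derive_eq (derD (der_cst _ _) (derN (der_id _))) _.
by rewrite add0r.
Qed.

Let der_posB n (m z : R) : is_derive z 1 (fun y : R => pos_part (m - y) ^+ n.+2)
  (- (n.+2%:R * pos_part (m - z) ^+ n.+1)).
Proof.
have D := der_comp (f := fun y => pos_part y ^+ n.+2) (g := fun y => m - y)
  (der_pos_part_exp n (m - z)) (der_sub m z).
by rewrite mulrN1 in D.
Qed.

Lemma der_pos_partM_primitive (a b z : R) :
  is_derive z 1 (pos_partM_primitive a b) (pos_part (a - z) * pos_part (b - z)).
Proof.
rewrite pos_partM_minmax /pos_partM_primitive; set m := Num.min a b; set M := Num.max a b.
apply: (is_derive_eq (derN (derD (derM (der_posB 1 m z) (der_cst 3^-1 z))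
  (derM (derM (der_cst (M - m) z) (der_posB 0 m z)) (der_cst 2^-1 z))))).
by rewrite !mulr0 !add0r expr1; field.
Qed.

Lemma der_pos_part_primitive (a z : R) :
  is_derive z 1 (fun y : R => - (pos_part (a - y) ^+ 2 / 2)) (pos_part (a - z)).
Proof.
apply: (is_derive_eq (derN (derM (der_posB 0 a z) (der_cst 2^-1 z)))).
by rewrite mulr0 add0r expr1; field.
Qed.

Lemma continuous_pos_partB (a : R) : continuous (fun z => pos_part (a - z)).
Proof.
move=> z; apply: (@continuous_max _ _ (fun=> 0) (fun z => a - z)).
  exact: cvg_cst.
by apply: cvgB; [exact: cvg_cst|exact: cvg_id].
Qed.

(** [ramp r x z] is the probability that [x + r U > z], with [U] uniform on the
unit interval. *)
Definition ramp (r x z : R) := (pos_part (x + r - z) - pos_part (x - z)) / r.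

(** [2 / r * smooth r `|x - y| + r / 3] is the mean of [|x + r U - y - r V|] for
independent uniform [U] and [V]. *)
Definition smooth (r t : R) : R :=
  t ^+ 2 / 2 - t ^+ 3 / (6 * r) + pos_part (t - r) ^+ 3 / (6 * r).

(** If [z] is uniform on an interval that contains [x + r U] and [y + r V], the
integrand is the probability that [z] does not separate these two points; its
integral is the length of the interval minus their mean distance. *)
Lemma Rintegral_ramp (r x y : R) : 0 < r -> 0 <= x <= 1 -> 0 <= y <= 1 ->
  \int[mu]_(z in `[0, 1 + r])
     (ramp r x z * ramp r y z + (1 - ramp r x z) * (1 - ramp r y z)) =
  1 + r - r / 3 - 2 / r * smooth r `|x - y|.
Proof.
move=> r0; wlog xy : x y / x <= y => [H x01 y01|].
  have [xy|/ltW yx] := leP x y; first exact: H.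
  rewrite distrC -H//; apply: eq_Rintegral => z _; ring.
move=> /andP[x0 x1] /andP[y0 y1].
pose F z := z - (- (pos_part (x + r - z) ^+ 2 / 2) - - (pos_part (x - z) ^+ 2 / 2)
              + (- (pos_part (y + r - z) ^+ 2 / 2) - - (pos_part (y - z) ^+ 2 / 2))) * r^-1
  + (pos_partM_primitive (x + r) (y + r) z - pos_partM_primitive (x + r) y z
     - (pos_partM_primitive x (y + r) z - pos_partM_primitive x y z)) * (2 / r ^+ 2).
rewrite (Rintegral_FTC (F := F)).
- have P0 (w : R) : w <= 0 -> pos_part w = 0 by move=> w0; rewrite /pos_part (max_idPl _).
  have P1 (w : R) : 0 <= w -> pos_part w = w by move=> w0; rewrite /pos_part (max_idPr _).
  have F1 : F (1 + r) = 1 + r.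
    have E w : w <= 1 + r -> pos_part (w - (1 + r)) = 0 by move=> h; rewrite P0// subr_le0.
    have E2 a b : a <= 1 + r -> pos_part (Num.min a b - (1 + r)) = 0.
      by move=> h; rewrite E// ge_min h.
    rewrite /F /pos_partM_primitive !(E x) ?(E y) ?(E (x + r)) ?(E (y + r)) ?E2; lra.
  have F0 : F 0 = - (- ((x + r) ^+ 2 / 2) + x ^+ 2 / 2
       - (y + r) ^+ 2 / 2 + y ^+ 2 / 2) / r
     - ((x + r) ^+ 3 / 3 + (y - x) * (x + r) ^+ 2 / 2
     - ((Num.min (x + r) y) ^+ 3 / 3 + 
        (Num.max (x + r) y - Num.min (x + r) y) * (Num.min (x + r) y) ^+ 2 / 2)
     - (x ^+ 3 / 3 + (y + r - x) * x ^+ 2 / 2)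
     + (x ^+ 3 / 3 + (y - x) * x ^+ 2 / 2)) * (2 / r ^+ 2).
    rewrite /F /pos_partM_primitive !subr0.
    rewrite (min_l (x := x + r) (y := y + r)) ?lerD2r// (max_r (x := x + r) (y := y + r)) ?lerD2r//.
    rewrite (min_l (x := x) (y := y))// (max_r (x := x) (y := y))//.
    rewrite (min_l (x := x) (y := y + r)) ?(max_r (x := x) (y := y + r)); [|lra|lra].
    rewrite !P1; [by field; rewrite gt_eqF| |lra|lra|lra|lra].
    by rewrite le_min y0 addr_ge0// ltW.
  rewrite F1 F0 /smooth distrC ger0_norm ?subr_ge0//.
  have [xry|yxr] := leP (x + r) y.
    by rewrite P1; [field; rewrite gt_eqF|lra].
  by rewrite P0; [field; rewrite gt_eqF|lra].
- by rewrite addr_gt0.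
- move=> z _; split.
    have cr w : {for z, continuous (ramp r w)}.
      by apply: cvgMr_tmp; apply: cvgB; exact: continuous_pos_partB.
    apply: cvgD; apply: cvgM; try exact: cr.
      by apply: cvgB; [exact: cvg_cst|exact: cr].
    by apply: cvgB; [exact: cvg_cst|exact: cr].
  have dB (f g : R -> R) a b : is_derive z 1 f a -> is_derive z 1 g b ->
    is_derive z 1 (fun y => f y - g y) (a - b).
    by move=> df dg; exact: derD df (derN dg).
  apply: (is_derive_eq (derD (dB _ _ _ _ (der_id z) (derM (derD
     (dB _ _ _ _ (der_pos_part_primitive (x + r) z) (der_pos_part_primitive x z)) 
     (dB _ _ _ _ (der_pos_part_primitive (y + r) z) (der_pos_part_primitive y z))) (der_cst r^-1 z)))
     (derM (dB _ _ _ _ (dB _ _ _ _ (der_pos_partM_primitive (x + r) (y + r) z) (der_pos_partM_primitive (x + r) y z))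
        (dB _ _ _ _ (der_pos_partM_primitive x (y + r) z) (der_pos_partM_primitive x y z))) (der_cst (2 / r ^+ 2) z)))).
  by rewrite !mulr0 !add0r /ramp; field; rewrite gt_eqF.
Qed.

End Ramps.

Section LinePsd.
Context (R : realType) (T : Type).
Notation mu := (@lebesgue_measure R).
Implicit Types (f : T -> R).

Lemma psd_subr_smooth f r : (forall x, 0 <= f x <= 1) -> 0 < r ->
  psd (fun x y => r / 2 + r ^+ 2 / 3 - smooth r `|f x - f y|).
Proof.
move=> f01 r0.
apply: (@psd_ext _ _ (fun x y => r / 2 * \int[mu]_(z in `[0, 1 + r])
    (ramp r (f x) z * ramp r (f y) z +
     (1 - ramp r (f x) z) * (1 - ramp r (f y) z)))).
  by move=> x y; rewrite Rintegral_ramp//; field; rewrite gt_eqF.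
apply: psdZ; first by rewrite divr_ge0// ltW.
apply: psd_Rintegral_itv => [z _|x y z _].
  apply: psdD; first exact: (psd_rank1 (fun x => ramp r (f x) z)).
  exact: (psd_rank1 (fun x => 1 - ramp r (f x) z)).
have cr w : {for z, continuous (ramp r w)}.
  by apply: cvgMr_tmp; apply: cvgB; exact: continuous_pos_partB.
apply: cvgD; apply: cvgM; try exact: cr.
  by apply: cvgB; [exact: cvg_cst|exact: cr].
by apply: cvgB; [exact: cvg_cst|exact: cr].
Qed.

(** The limit of the previous kernels, rescaled, as the scale tends to 0. *)
Lemma psd_1Bdist f : (forall x, 0 <= f x <= 1) ->
  psd (fun x y => 1 - `|f x - f y|).
Proof.
move=> f01; apply: (psd_lim (F := 0^'+) (K := fun r x y =>
    2 / r * (r / 2 + r ^+ 2 / 3 - smooth r `|f x - f y|))).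
  near=> r; have r0 : 0 < r by [].
  by apply: psdZ; [rewrite divr_ge0// ltW|exact: psd_subr_smooth].
move=> x y; set t := `|f x - f y|.
have [t0|t0] := eqVneq t 0.
  rewrite t0 subr0.
  have H : 1 + 2 / 3 * r @[r --> 0^'+] --> (1 : R).
    rewrite -[X in _ --> X]addr0; apply: cvgD; first exact: cvg_cst.
    rewrite -[X in _ --> X](mulr0 (2 / 3)); apply: cvgMl_tmp.
    by apply: cvg_at_right_filter; exact: cvg_id.
  apply: cvg_trans H; apply: near_eq_cvg; near=> r.
  have r0 : 0 < r by [].
  rewrite /smooth /pos_part (max_idPl _); last by lra.
  by field; rewrite gt_eqF.
have tp : 0 < t by rewrite lt_neqAle eq_sym t0 normr_ge0.
have H : 1 - t + r @[r --> 0^'+] --> 1 - t.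
  rewrite -[X in _ --> X]addr0; apply: cvgD; first exact: cvg_cst.
  by apply: cvg_at_right_filter; exact: cvg_id.
apply: cvg_trans H; apply: near_eq_cvg; near=> r.
have r0 : 0 < r by [].
have rt : r < t by near: r; exact: nbhs_right_lt.
rewrite /smooth /pos_part (max_idPr _); last by rewrite subr_ge0 ltW.
by field; rewrite gt_eqF.
Unshelve. all: by end_near. Qed.

Lemma powR_shift (r s : R) n : 0 < r -> r `^ (s + n%:R) = r `^ s * r ^+ n.
Proof.
move=> r0; rewrite powRD; last by rewrite (gt_eqF r0) implybT.
by rewrite powR_mulrn// ltW.
Qed.

Lemma smooth_weight_continuous (p t r : R) : 0 < r ->
  {for r, continuous (fun u : R => u `^ (p - 4) * (u * (u - smooth u t)))}.
Proof.
move=> r0.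
apply: cvgM; first exact: (der_continuous (is_derive1_powR (p - 4) r0)).
apply: cvgM; first exact: cvg_id.
apply: cvgB; first exact: cvg_id.
apply: cvgD; first (apply: cvgB; first exact: cvg_cst).
  apply: cvgMl_tmp; apply: cvgV; first by rewrite mulf_neq0 ?gt_eqF.
  by apply: cvgMl_tmp; exact: cvg_id.
apply: cvgM.
  exact: der_continuous (der_comp (f := fun z => pos_part z ^+ 3) (g := fun z => t - z)
    (der_pos_part_exp 1 (t - r)) (derD (der_cst t r) (derN (der_id r)))).
apply: cvgV; first by rewrite mulf_neq0 ?gt_eqF.
by apply: cvgMl_tmp; exact: cvg_id.
Qed.

Lemma Rintegral_smooth0 (p e : R) : 1 < p -> 0 < e -> e < 1 ->
  \int[mu]_(r in `[e, 1]) (r `^ (p - 4) * (r * (r - smooth r 0))) =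
  (1 - e `^ (p - 1)) / (p - 1).
Proof.
move=> p1 e0 e1.
rewrite (Rintegral_FTC (F := fun z => z `^ (p - 1) / (p - 1)))//.
  by rewrite powR1 mulrBl.
move=> r; rewrite in_itv/= => /andP[er _]; have r0 : 0 < r by lra.
split; first exact: smooth_weight_continuous.
apply: (is_derive_eq (derM (is_derive1_powR (p - 1) r0) (der_cst (p - 1)^-1 r))).
have -> : p - 1 - 1 = p - 4 + 2%:R by ring.
rewrite powR_shift// /smooth /pos_part (max_idPl _); last by lra.
by field; lra.
Qed.

(** The scale [r] enters with weight [r `^ (p - 3)], the homogeneity that
produces [t `^ p]; cutting the scales off at 1 only leaves multiples of [t ^+ 2]
and [t ^+ 3]. The term [r] in [r - smooth r t] makes each kernel positive
semidefinite for [r <= 1], and its weight [r `^ (p - 2)] is integrable at 0. *)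
Lemma Rintegral_smooth (p t e : R) : 1 < p < 2 -> 0 < e -> e < t -> t <= 1 ->
  \int[mu]_(r in `[e, 1]) (r `^ (p - 4) * (r * (r - smooth r t))) =
  (1 - e `^ (p - 1)) / (p - 1) + t ^+ 2 / (2 * (2 - p)) -
  t ^+ 3 / (6 * (3 - p)) - t `^ p / (p * (p - 1) * (2 - p) * (3 - p)) +
  t * e `^ (p - 1) / (2 * (p - 1)) - e `^ p / (6 * p).
Proof.
move=> /andP[p1 p2] e0 et t1; have t0 : 0 < t := lt_trans e0 et.
pose s := p - 4.
have d1 (r : R) : 0 < r -> is_derive r 1 (fun z : R => z `^ (p - 3) / (p - 3)) (r `^ s).
  move=> r0.
  apply: (is_derive_eq (derM (is_derive1_powR (p - 3) r0) (der_cst (p - 3)^-1 r))).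
  have -> : p - 3 - 1 = s by rewrite /s; ring.
  by field; lra.
have d2 (r : R) : 0 < r -> is_derive r 1 (fun z : R => z `^ (p - 2) / (p - 2)) (r `^ s * r).
  move=> r0.
  apply: (is_derive_eq (derM (is_derive1_powR (p - 2) r0) (der_cst (p - 2)^-1 r))).
  have -> : p - 2 - 1 = s + 1%:R by rewrite /s; ring.
  by rewrite powR_shift//; field; lra.
have d3 (r : R) : 0 < r -> is_derive r 1 (fun z : R => z `^ (p - 1) / (p - 1)) (r `^ s * r ^+ 2).
  move=> r0.
  apply: (is_derive_eq (derM (is_derive1_powR (p - 1) r0) (der_cst (p - 1)^-1 r))).
  have -> : p - 1 - 1 = s + 2%:R by rewrite /s; ring.
  by rewrite powR_shift//; field; lra.
have d4 (r : R) : 0 < r -> is_derive r 1 (fun z : R => z `^ p / p) (r `^ s * r ^+ 3).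
  move=> r0.
  apply: (is_derive_eq (derM (is_derive1_powR p r0) (der_cst p^-1 r))).
  have -> : p - 1 = s + 3%:R by rewrite /s; ring.
  by rewrite powR_shift//; field; lra.
pose Y r := t ^+ 3 * (r `^ (p - 3) / (p - 3)) - 3 * t ^+ 2 * (r `^ (p - 2) / (p - 2))
  + 3 * t * (r `^ (p - 1) / (p - 1)) - r `^ p / p.
have dY (r : R) : 0 < r -> is_derive r 1 Y (r `^ s * (t - r) ^+ 3).
  move=> r0.
  apply: (is_derive_eq (derD (derD (derD (derM (der_cst _ _) (d1 r r0))
    (derN (derM (der_cst _ _) (d2 r r0)))) (derM (der_cst _ _) (d3 r r0)))
    (derN (d4 r r0)))).
  by ring.
(* the primitive of the truncated cube, continued by a constant beyond [t] *)
pose W r := if r < t then Y r else Y t.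
have dW (r : R) : 0 < r -> is_derive r 1 W (r `^ s * pos_part (t - r) ^+ 3).
  move=> r0; have [rt|tr|rt] := ltgtP r t.
  - rewrite /pos_part (max_idPr _) ?subr_ge0 ?ltW//.
    apply: (der_glue (dY r r0) (dY r r0)); rewrite /W ?rt//.
    by near=> z; rewrite ifT; [left|near: z; exact: lt_nbhsl].
  - rewrite /pos_part (max_idPl _) ?subr_le0 ?ltW// expr0n mulr0.
    apply: (der_glue (der_cst (Y t) r) (der_cst (Y t) r)); rewrite /W ?ltNge ?(ltW tr)//.
    by near=> z; rewrite ifF; [left|apply/negbTE; rewrite -leNgt ltW//; near: z; exact: lt_nbhsr].
  - rewrite rt subrr /pos_part maxxx expr0n mulr0.
    have dYt : is_derive t 1 Y 0 by have := dY t t0; rewrite subrr expr0n mulr0.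
    apply: (der_glue dYt (der_cst (Y t) t)); rewrite /W ?ltxx//.
    by near=> z; case: ifP; [left|right].
pose P r := r `^ (p - 1) / (p - 1) - t ^+ 2 / 2 * (r `^ (p - 2) / (p - 2)) +
  t ^+ 3 / 6 * (r `^ (p - 3) / (p - 3)) - 6^-1 * W r.
rewrite (Rintegral_FTC (F := P)).
- have W1 : W 1 = Y t.
    by rewrite /W; case: ltP => // h; congr Y; apply/eqP; rewrite eq_le t1 ltW.
  have We : W e = Y e by rewrite /W et.
  rewrite /P W1 We /Y !powR1.
  have tE n : t `^ (p - n%:R) = t `^ p / t ^+ n.
    have := powR_shift (p - n%:R) n t0; rewrite subrK => ->.
    by rewrite mulfK// expf_neq0// gt_eqF.
  have -> : t `^ (p - 1) = t `^ p / t ^+ 1 by exact: (tE 1%N).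
  rewrite (tE 2%N) (tE 3%N).
  field; lra.
- lra.
- move=> r; rewrite in_itv/= => /andP[er r1]; have r0 : 0 < r by lra.
  split; last first.
    apply: (is_derive_eq (derD (derD (derD (d3 r r0)
      (derN (derM (der_cst _ _) (d2 r r0)))) (derM (der_cst _ _) (d1 r r0)))
      (derN (derM (der_cst _ _) (dW r r0))))).
    rewrite !mulr0 !addr0 /smooth -/s.
    by field; lra.
  exact: (@smooth_weight_continuous p t r r0).
Unshelve. all: by end_near. Qed.

End LinePsd.

Section LinePower.
Context (R : realType) (T : Type).
Notation mu := (@lebesgue_measure R).
Implicit Types (f : T -> R).

(** The constants of [psd_subr_smooth] are not integrable against the weight
[r `^ (p - 3)] at large scales. The scales beyond 1 are therefore summed first:
for [t <= 1] they add up to a multiple of [smooth] at one finite scale. *)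
Lemma psd_subr_dist_powR_gt1 f p : (forall x, 0 <= f x <= 1) -> 1 < p < 2 ->
  exists c, psd (fun x y => c - `|f x - f y| `^ p).
Proof.
move=> f01 p12; have /andP[p1 p2] := p12.
have dist01 x y : 0 <= `|f x - f y| <= 1.
  rewrite normr_ge0 ler_norml; have := f01 x; have := f01 y; lra.
(* for [t <= 1], the integral of [smooth u t] against [u `^ (p - 3)] over
   [u >= 1] is [(2 - p)^-1 * smooth r t] *)
pose r := (3 - p) / (2 - p); have r1 : 1 < r by rewrite ltr_pdivlMr; lra.
pose C := r / 2 + r ^+ 2 / 3.
pose K := (p * (p - 1) * (2 - p) * (3 - p))^-1.
have K0 : 0 < K by rewrite invr_gt0 !mulr_gt0//; lra.
suff H : psd (fun x y => (p - 1)^-1 + (2 - p)^-1 * C - K * `|f x - f y| `^ p).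
  exists (K^-1 * ((p - 1)^-1 + (2 - p)^-1 * C)).
  apply: (@psd_ext _ _ (fun x y => 
      K^-1 * ((p - 1)^-1 + (2 - p)^-1 * C - K * `|f x - f y| `^ p))).
    by move=> x y; rewrite mulrBr mulKf// gt_eqF.
  by apply: psdZ => //; rewrite invr_ge0 ltW.
pose A e x y := \int[mu]_(u in `[e, 1])
  (u `^ (p - 4) * (u * (u - smooth u `|f x - f y|))).
apply: (psd_lim (F := 0^'+) (K := fun e x y =>
  A e x y + (2 - p)^-1 * (C - smooth r `|f x - f y|))).
  near=> e; have e0 : 0 < e by [].
  apply: psdD; last first.
    apply: psdZ; first by rewrite invr_ge0; lra.
    by apply: psd_subr_smooth => //; lra.
  apply: psd_Rintegral_itv => [u|x y u].
    rewrite in_itv/= => /andP[eu u1]; have u0 : 0 < u by lra.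
    apply: psdZ; first exact: powR_ge0.
    apply: psdZ; first exact: ltW.
    apply: (@psd_ext _ _ (fun x y => u / 2 + u ^+ 2 / 3 - smooth u `|f x - f y| +
        (u / 2 - u ^+ 2 / 3))).
      by move=> x y; set w := smooth _ _; field.
    apply: psdD; first exact: psd_subr_smooth.
    by apply: psd_cst; rewrite subr_ge0 expr2; nra.
  rewrite in_itv/= => /andP[eu u1]; have u0 : 0 < u by lra.
  exact: smooth_weight_continuous.
move=> x y; set t := `|f x - f y|.
have cst_cvg (l c : R) : 0 < l -> c * e `^ l @[e --> 0^'+] --> 0.
  move=> l0; rewrite -[X in _ --> X](mulr0 c); apply: cvgMl_tmp.
  exact: powR_cvg0.
have H : (p - 1)^-1 + (2 - p)^-1 * C - K * t `^ p
     + ((t / 2 - 1) / (p - 1)) * e `^ (p - 1) + (- (t != 0)%:R / (6 * p)) * e `^ p 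
   @[e --> 0^'+] --> (p - 1)^-1 + (2 - p)^-1 * C - K * t `^ p.
  rewrite -[X in _ --> X]addr0; apply: cvgD; last by apply: cst_cvg; lra.
  rewrite -[X in _ --> X]addr0; apply: cvgD; last by apply: cst_cvg; lra.
  exact: cvg_cst.
have /andP[_ t1] := dist01 x y; rewrite -/t in t1.
have smr : smooth r t = t ^+ 2 / 2 - t ^+ 3 / (6 * r).
  by rewrite /smooth /pos_part (max_idPl _) ?expr0n ?mul0r ?addr0//; lra.
apply: cvg_trans H; apply: near_eq_cvg; rewrite /A -/t smr.
have [t0|tn0] := eqVneq t 0.
  near=> e; have e0 : 0 < e by [].
  have e1 : e < 1 by near: e; exact: nbhs_right_lt.
  rewrite t0 powR0; last by rewrite gt_eqF; lra.
  have -> : \int[mu]_(u in `[e, 1]) (u `^ (p - 4) * (u * (u - smooth u 0))) =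
     (1 - e `^ (p - 1)) / (p - 1).
    exact: Rintegral_smooth0.
  by rewrite /=; field; lra.
have tp : 0 < t by rewrite lt_neqAle eq_sym tn0 normr_ge0.
near=> e; have e0 : 0 < e by [].
have et : e < t by near: e; exact: nbhs_right_lt.
rewrite Rintegral_smooth// /= /K /r.
by field; lra.
Unshelve. all: by end_near. Qed.

Lemma psd_subr_dist_powR f p b : (forall x, `|f x| <= b) -> 0 < p < 2 ->
  exists c, psd (fun x y => c - `|f x - f y| `^ p).
Proof.
move=> fb /andP[p0 p2].
pose B := `|b| + 1; have B0 : 0 < B by rewrite ltr_pwDr.
pose g x := (f x + B) / (2 * B).
have g01 x : 0 <= g x <= 1.
  have := le_trans (fb x) (ler_norm b); rewrite ler_norml => /andP[h1 h2].
  by rewrite divr_ge0 ?ler_pdivrMr ?mul1r /B /=; lra.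
suff [c pc] : exists c, psd (fun x y => c - `|g x - g y| `^ p).
  exists ((2 * B) `^ p * c).
  apply: (@psd_ext _ _ (fun x y => (2 * B) `^ p * (c - `|g x - g y| `^ p))).
    move=> x y; rewrite mulrBr -powRM ?normr_ge0//; last by rewrite mulr_ge0// ltW.
    congr (_ - _ `^ _).
    have -> : g x - g y = (f x - f y) / (2 * B) by rewrite /g; field; rewrite gt_eqF.
    rewrite normrM normfV (ger0_norm (x := 2 * B)); last by rewrite mulr_ge0// ltW.
    by rewrite mulrC divfK// mulf_neq0// gt_eqF.
  by apply: psdZ => //; exact: powR_ge0.
have [p1|p1] := leP p 1.
  exists ((2 * 1) `^ p).
  apply: (psd_subr_powR (s := fun x y => `|g x - g y|)) => //.
  - by move=> x; rewrite subrr normr0.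
  - exact: psd_1Bdist.
  - by rewrite p0.
by apply: psd_subr_dist_powR_gt1 => //; rewrite p1.
Qed.

End LinePower.

(** * Bounded subsets of Euclidean space *)

Section AffineSubstitution.
Context (R : realType).
Notation mu := (@lebesgue_measure R).

Let der_affine (a c x : R) : is_derive x 1 (fun u : R => a * u + c) a.
Proof.
apply: (is_derive_eq (derD (derM (der_cst a x) (der_id x)) (der_cst c x))).
by rewrite mulr1 mulr0 !addr0.
Qed.

Lemma ge0_integral_affine (a c : R) (G : R -> R) : 0 < a -> continuous G ->
  (forall x, 0 <= G x) ->
  (\int[mu]_x (G x)%:E = \int[mu]_x (G (a * x + c) * a)%:E)%E.
Proof.
move=> a0 cG G0; pose F x := a * x + c.
have F' : derive1 F = cst a.
  by apply/funext => x; rewrite derive1E; have [_ ->] := der_affine a c x.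
rewrite (@increasing_ge0_integration_by_substitutionT _ F)//.
- by apply: eq_integral => x _; rewrite F'.
- by move=> x y xy; rewrite /F ltrD2r ltr_pM2l.
- by rewrite F' => x; exact: cvg_cst.
- by rewrite F'; exact: is_cvg_cst.
- by rewrite F'; exact: is_cvg_cst.
- apply/cvgrNyPle => A; near=> x.
  rewrite /F -lerBrDr mulrC -ler_pdivlMr//; near: x; exact: nbhs_ninfty_le.
- apply/cvgryPge => A; near=> x.
  rewrite /F -lerBlDr mulrC -ler_pdivrMr//; near: x; exact: nbhs_pinfty_ge.
Unshelve. all: by end_near. Qed.

Lemma ge0_integral_oppr (f : R -> \bar R) : measurable_fun [set: R] f ->
  (forall x, 0 <= f x)%E -> (\int[mu]_x f x = \int[mu]_x f (- x)%R)%E.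
Proof.
move=> mf f0.
transitivity (\int[pushforward mu (-%R : _ -> measurableTypeR R)]_x f x)%E.
  by apply: eq_measure_integral => //= A mA _; exact/esym/lebesgue_measureN.
by rewrite ge0_integral_pushforward.
Qed.

End AffineSubstitution.

Section Gaussian.
Context (R : realType).
Notation mu := (@lebesgue_measure R).
Implicit Types a b e u v : R.

Definition gauss (u : R) : R := normal_pdf 0 1 u.

Lemma gauss_ge0 u : 0 <= gauss u. Proof. exact: normal_pdf_ge0. Qed.

Lemma measurable_gauss : measurable_fun [set: R] gauss.
Proof. exact: measurable_normal_pdf. Qed.

Lemma integrable_gauss : mu.-integrable [set: R] (EFin \o gauss).
Proof. exact: integrable_normal_pdf. Qed.

Lemma Rintegral_gauss : \int[mu]_u gauss u = 1.
Proof. by rewrite /Rintegral integral_normal_pdf. Qed.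

(** [`|u| * gauss u] is below a multiple of the density of variance 2, since
[`|u| <= 1 + u ^+ 2 / 4 <= expR (u ^+ 2 / 4)]. *)
Lemma integrable_norm_gauss : mu.-integrable [set: R] (fun u => (`|u| * gauss u)%:E).
Proof.
have s0 : Num.sqrt 2 != 0 :> R by rewrite gt_eqF// sqrtr_gt0.
pose k : R := normal_peak 1 / normal_peak (Num.sqrt 2).
apply: (@le_integrable _ _ _ mu _ measurableT _
    (fun u => k%:E * (normal_pdf 0 (Num.sqrt 2) u)%:E)%E).
- apply/measurable_EFinP; apply: measurable_funM; last exact: measurable_gauss.
  by apply: continuous_measurable_fun; exact: norm_continuous.
- move=> u _; rewrite -EFinM !abse_EFin lee_fin.
  rewrite [leLHS]ger0_norm; last by rewrite mulr_ge0// gauss_ge0.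
  rewrite [leRHS]ger0_norm; last first.
    by rewrite mulr_ge0 ?divr_ge0 ?normal_peak_ge0 ?normal_pdf_ge0.
  rewrite /gauss !normal_pdfE ?oner_eq0// /k.
  rewrite [leRHS]mulrA divfK ?gt_eqF ?normal_peak_gt0//.
  rewrite mulrCA ler_wpM2l ?normal_peak_ge0// /normal_fun !subr0 sqr_sqrtr//.
  rewrite expr1n.
  have -> : - u ^+ 2 / (2 *+ 2) = u ^+ 2 / 4 + - u ^+ 2 / (1 *+ 2) by field.
  rewrite expRD ler_wpM2r ?expR_ge0//; apply: le_trans (expR_ge1Dx _).
  have -> : u ^+ 2 = `|u| ^+ 2 by rewrite real_normK// num_real.
  have := sqr_ge0 (`|u| / 2 - 1). lra.
- by apply: integrableZl => //; exact: integrable_normal_pdf.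
Qed.

Lemma integrable_absint a e :
  mu.-integrable [set: R] (fun u => (`|a * u + e| * gauss u)%:E).
Proof.
have i1 : mu.-integrable [set: R] (fun u =>
    `|a|%:E * (`|u| * gauss u)%:E + `|e|%:E * (gauss u)%:E)%E.
  by apply: integrableD => //; apply: integrableZl => //; 
    [exact: integrable_norm_gauss|exact: integrable_gauss].
apply: (le_integrable measurableT _ _ i1).
  apply/measurable_EFinP; apply: measurable_funM; last exact: measurable_gauss.
  apply: continuous_measurable_fun => u; apply: cvg_norm; apply: cvgD; last exact: cvg_cst.
  by apply: cvgMl_tmp; exact: cvg_id.
move=> u _; rewrite -!EFinM -EFinD !abse_EFin lee_fin.
have g0 := gauss_ge0 u.
rewrite [leLHS]ger0_norm ?mulr_ge0// [leRHS]ger0_norm ?addr_ge0 ?mulr_ge0//.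
by rewrite mulrA -mulrDl ler_wpM2r// -normrM ler_normD.
Qed.

(** The mean of [`|e + a u|] over a standard normal [u]: as a function of
[a ^+ 2] and [e], the heat flow started at the absolute value. *)
Definition absmean a e : R := \int[mu]_u (`|a * u + e| * gauss u).

Lemma absmeanE a e :
  (\int[mu]_u (`|a * u + e| * gauss u)%:E = (absmean a e)%:E)%E.
Proof. by rewrite fineK//; exact: (integrable_fin_num measurableT (integrable_absint a e)). Qed.

Lemma absmean0 e : absmean 0 e = `|e|.
Proof.
rewrite /absmean; under eq_Rintegral do rewrite mul0r add0r.
by rewrite RintegralZl//; [rewrite Rintegral_gauss mulr1|exact: integrable_gauss].
Qed.

Lemma absmeanN a e : absmean (- a) e = absmean a e.
Proof.
rewrite /absmean /Rintegral; congr fine.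
rewrite [RHS]ge0_integral_oppr.
- apply: eq_integral => u _; rewrite mulrN mulNr.
  by rewrite /gauss !normal_pdfE ?oner_eq0// /normal_fun !subr0 sqrrN.
- by have /measurable_int := integrable_absint a e.
- by move=> u; rewrite lee_fin mulr_ge0// gauss_ge0.
Qed.

(** Completing the square in [u] splits the joint density of [v] and [u] into
the density of [v], of variance [a ^+ 2 + b ^+ 2], and the conditional density
of [u] given [v]. *)
Lemma normal_pdf_convolution a b v u : 0 < a ->
  let r := Num.sqrt (a ^+ 2 + b ^+ 2) in
  normal_pdf 0 a (v - b * u) * gauss u =
  normal_pdf 0 r v * normal_pdf (v * b / r ^+ 2) (a / r) u.
Proof.
move=> a0 r; have r2 : r ^+ 2 = a ^+ 2 + b ^+ 2.
  by rewrite sqr_sqrtr// addr_ge0// sqr_ge0.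
have r0 : 0 < r by rewrite sqrtr_gt0 ltr_wpDr ?sqr_ge0// exprn_gt0.
have [an rn] : a != 0 /\ r != 0 by rewrite !gt_eqF.
rewrite /gauss !normal_pdfE ?mulf_neq0 ?invr_neq0 ?oner_eq0//.
rewrite mulrACA [RHS]mulrACA; congr (_ * _).
  rewrite /normal_peak -!invfM -!sqrtrM; last 2 first.
  - by rewrite mulrn_wge0// mulr_ge0 ?pi_ge0// sqr_ge0.
  - by rewrite mulrn_wge0// mulr_ge0 ?pi_ge0// sqr_ge0.
  by congr (Num.sqrt _)^-1; field.
rewrite /normal_fun -!expRD; congr expR.
have -> : (a / r) ^+ 2 = a ^+ 2 / r ^+ 2 by field.
rewrite r2; field; rewrite -r2.
by rewrite expf_neq0.
Qed.

End Gaussian.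

Section GaussianMixture.
Context (R : realType).
Notation mu := (@lebesgue_measure R).
Implicit Types a b e u v : R.

Lemma normal_pdf_scale a u : 0 < a -> normal_pdf 0 a (a * u) * a = gauss u.
Proof.
move=> a0; have an : a != 0 by rewrite gt_eqF.
rewrite /gauss !normal_pdfE ?oner_eq0// mulrAC; congr (_ * _); last first.
  by rewrite /normal_fun !subr0; congr expR; field.
rewrite /normal_peak -!mulrnAr sqrtrM ?sqr_ge0// sqrtr_sqr gtr0_norm//.
by rewrite expr1n mul1r invfM mulrAC mulVf// mul1r.
Qed.

(** Change the order of integration after replacing [a u + b t] by [v]. *)
Lemma absmean_mix_gt0 a b e : 0 < a ->
  (\int[mu]_t (absmean a (b * t + e) * gauss t)%:E =
   (absmean (Num.sqrt (a ^+ 2 + b ^+ 2)) e)%:E)%E.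
Proof.
move=> a0; set r := Num.sqrt _.
have an : a != 0 by rewrite gt_eqF.
have r0 : 0 < r by rewrite sqrtr_gt0 ltr_wpDr ?sqr_ge0// exprn_gt0.
pose f (z : R * R) : \bar R := (`|z.2 + e| * (normal_pdf 0 a (z.2 - b * z.1) * gauss z.1))%:E.
have f0 z : (0 <= f z)%E.
  by rewrite lee_fin !mulr_ge0 ?normal_pdf_ge0// gauss_ge0.
have mf : measurable_fun [set: R * R] f.
  apply/measurable_EFinP; apply: measurable_funM.
    apply: measurableT_comp => //; apply: measurable_funD => //.
  apply: measurable_funM.
    apply: (measurableT_comp (measurable_normal_pdf 0 a)).
    by apply: measurable_funB => //; apply: measurable_funM.
  exact: (measurableT_comp (@measurable_gauss R) measurable_fst).
transitivity (\int[mu]_t \int[mu]_v f (t, v))%E.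
  apply: eq_integral => t _.
  have -> : ((absmean a (b * t + e) * gauss t)%:E =
      \int[mu]_u ((gauss t)%:E * (`|a * u + (b * t + e)| * gauss u)%:E))%E.
    rewrite (@ge0_integralZl _ _ _ mu _ measurableT).
    - by rewrite absmeanE -EFinM mulrC.
    - by have /measurable_int := integrable_absint a (b * t + e).
    - by move=> u _; rewrite lee_fin mulr_ge0// gauss_ge0.
    - by rewrite lee_fin gauss_ge0.
  rewrite [RHS](@ge0_integral_affine _ a (b * t)
    (fun v => `|v + e| * (normal_pdf 0 a (v - b * t) * gauss t)))//.
  - apply: eq_integral => u _; rewrite -EFinM; congr EFin.
    by rewrite addrK -(normal_pdf_scale u a0) addrA; ring.
  - move=> v; apply: cvgM.
      by apply: cvg_norm; apply: cvgD; [exact: cvg_id|exact: cvg_cst].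
    apply: cvgMr_tmp.
    apply: (@continuous_comp _ _ _ (fun v : R => v - b * t) (normal_pdf 0 a));
      last exact: continuous_normal_pdf.
    by apply: cvgB; [exact: cvg_id|exact: cvg_cst].
  - by move=> v; rewrite !mulr_ge0 ?normal_pdf_ge0// gauss_ge0.
rewrite (fubini_tonelli (m1 := mu) (m2 := mu) _ mf f0) -absmeanE.
rewrite [RHS](_ : _ = \int[mu]_v (`|v + e| * normal_pdf 0 r v)%:E)%E; last first.
  rewrite [RHS](@ge0_integral_affine _ r 0 (fun v => `|v + e| * normal_pdf 0 r v))//.
  - apply: eq_integral => u _; congr EFin.
    by rewrite addr0 -(normal_pdf_scale u r0); ring.
  - move=> v; apply: cvgM; last by apply: continuous_normal_pdf; rewrite gt_eqF.
    by apply: cvg_norm; apply: cvgD; [exact: cvg_id|exact: cvg_cst].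
  - by move=> v; rewrite mulr_ge0// normal_pdf_ge0.
apply: eq_integral => v _.
under eq_integral do rewrite /f /= normal_pdf_convolution// mulrA EFinM.
rewrite ge0_integralZl//.
- by rewrite integral_normal_pdf mule1.
- by apply/measurable_EFinP; exact: measurable_normal_pdf.
- by move=> u _; rewrite lee_fin normal_pdf_ge0.
- by rewrite lee_fin mulr_ge0// normal_pdf_ge0.
Qed.

Lemma absmean_norml a e : absmean `|a| e = absmean a e.
Proof.
by have [a0|a0] := leP 0 a; [rewrite ger0_norm|rewrite ltr0_norm// absmeanN].
Qed.

(** A sum of independent centred normal variables is normal. *)
Lemma absmean_mix a b e : 0 <= a ->
  (\int[mu]_t (absmean a (b * t + e) * gauss t)%:E =
   (absmean (Num.sqrt (a ^+ 2 + b ^+ 2)) e)%:E)%E.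
Proof.
rewrite le_eqVlt => /orP[/eqP<-|]; last exact: absmean_mix_gt0.
rewrite expr0n add0r sqrtr_sqr absmean_norml -absmeanE.
by apply: eq_integral => t _; rewrite absmean0.
Qed.

Lemma absmean_ge0 a e : 0 <= absmean a e.
Proof. by apply: Rintegral_ge0 => u _; rewrite mulr_ge0// gauss_ge0. Qed.

Lemma integrable_absmean a b e : 0 <= a ->
  mu.-integrable [set: R] (EFin \o (fun t => absmean a (b * t + e) * gauss t)).
Proof.
move=> a0; apply/integrableP; split.
  pose f (z : R * R) : \bar R := (`|a * z.2 + (b * z.1 + e)| * gauss z.2)%:E.
  have mf : measurable_fun [set: R * R] f.
    apply/measurable_EFinP; apply: measurable_funM.
      apply: measurableT_comp => //; apply: measurable_funD => //.
        exact: measurable_funM.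
      by apply: measurable_funD => //; apply: measurable_funM.
    exact: (measurableT_comp (@measurable_gauss R) measurable_snd).
  have f0 z : (0 <= f z)%E by rewrite lee_fin mulr_ge0// gauss_ge0.
  have := measurable_fun_fubini_tonelli_F (m2 := mu) f mf f0.
  rewrite /fubini_F /f /=; under eq_fun do rewrite absmeanE.
  move=> /measurable_EFinP h; apply/measurable_EFinP.
  by apply: measurable_funM => //; exact: measurable_gauss.
under eq_integral do rewrite /= ger0_norm ?mulr_ge0 ?absmean_ge0 ?gauss_ge0//.
by rewrite absmean_mix// ltry.
Qed.

End GaussianMixture.

Section EuclideanPsd.
Context (R : realType) (T : Type).
Notation mu := (@lebesgue_measure R).

Lemma psd_subr_dist (h : T -> R) B : (forall x, `|h x| <= B) ->
  psd (fun x y => 2 * B - `|h x - h y|).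
Proof.
move=> hB; have [B0|B0] := leP B 0.
  have h0 x : h x = 0 by apply/eqP; rewrite -normr_le0 (le_trans (hB x)).
  split=> [x y|n x c]; first by rewrite !h0.
  rewrite /qform; case: n => [|n] in x c *; first by rewrite big_ord0.
  have -> : B = 0 by apply/le_anti; rewrite B0 (le_trans _ (hB (x ord0))).
  rewrite big1// => i _; rewrite big1// => j _.
  by rewrite !h0 subrr normr0 mulr0 subrr mulr0.
have B2 : 0 < 2 * B by rewrite mulr_gt0.
apply: (@psd_ext _ _ (fun x y =>
    2 * B * (1 - `|(h x + B) / (2 * B) - (h y + B) / (2 * B)|))).
  move=> x y; rewrite mulrBr mulr1; congr (_ - _).
  rewrite -{1}(gtr0_norm B2) -normrM; congr `|_|.
  by field; rewrite gt_eqF.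
apply: psdZ; first exact: ltW.
apply: (psd_1Bdist (f := fun x => (h x + B) / (2 * B))) => x.
have := hB x; rewrite ler_norml => /andP[h1 h2].
by rewrite divr_ge0 ?(ltW B2) ?ler_pdivrMr ?mul1r//=; lra.
Qed.

(** The induction turns one coordinate after the other into a normal variable:
[h] stands for the linear form in the coordinates still to come, and averaging
over the coefficient of the next one increases the variance of the part that is
already averaged. *)
Lemma psd_subr_absmean (I : Type) (s : seq I) (f : I -> T -> R) b :
  (forall i x, `|f i x| <= b) ->
  exists c, forall h B, (forall x, `|h x| <= B) ->
  psd (fun x y => c + 2 * B -
    absmean (Num.sqrt (\sum_(i <- s) (f i x - f i y) ^+ 2)) (h x - h y)).
Proof.
move=> fb; elim: s => [|i s [c IH]].
  exists 0 => h B hB; apply: (@psd_ext _ _ (fun x y => 2 * B - `|h x - h y|)).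
    by move=> x y; rewrite big_nil sqrtr0 absmean0 add0r.
  exact: psd_subr_dist.
pose M : R := \int[mu]_t (`|t| * gauss t).
exists (c + 2 * b * M) => h B hB.
pose S x y := Num.sqrt (\sum_(j <- s) (f j x - f j y) ^+ 2).
have S0 x y : 0 <= \sum_(j <- s) (f j x - f j y) ^+ 2.
  by apply: sumr_ge0 => j _; exact: sqr_ge0.
pose K t x y := (c + 2 * B) * gauss t + 2 * b * (`|t| * gauss t) -
  absmean (S x y) ((f i x - f i y) * t + (h x - h y)) * gauss t.
have i1 : mu.-integrable [set: R] (EFin \o (fun t => (c + 2 * B) * gauss t)).
  exact: (integrableZl measurableT (c + 2 * B) (@integrable_gauss R)).
have i2 : mu.-integrable [set: R] (EFin \o (fun t => 2 * b * (`|t| * gauss t))).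
  exact: (integrableZl measurableT (2 * b) (@integrable_norm_gauss R)).
have i3 x y := integrable_absmean (f i x - f i y) (h x - h y)
  (sqrtr_ge0 (\sum_(j <- s) (f j x - f j y) ^+ 2)).
have i12 : mu.-integrable [set: R] (EFin \o
    (fun t => (c + 2 * B) * gauss t + 2 * b * (`|t| * gauss t))).
  exact: (integrableD measurableT i1 i2).
apply: (@psd_ext _ _ (fun x y => \int[mu]_t K t x y)).
  move=> x y; rewrite /K (RintegralB measurableT i12 (i3 x y)).
  rewrite (RintegralD measurableT i1 i2).
  rewrite (RintegralZl _ measurableT (@integrable_gauss R)).
  rewrite (RintegralZl _ measurableT (@integrable_norm_gauss R)).
  rewrite Rintegral_gauss -/M /Rintegral absmean_mix ?sqrtr_ge0//=.
  by rewrite sqr_sqrtr// big_cons addrC (addrC (_ ^+ 2)); ring.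
apply: psd_Rintegral => // [t _|x y]; last first.
  exact: (integrableB measurableT i12 (i3 x y)).
apply: (@psd_ext _ _ (fun x y => gauss t * (c + 2 * (B + `|t| * b) -
    absmean (S x y) ((h x + t * f i x) - (h y + t * f i y))))).
  move=> x y; rewrite /K.
  have -> : (h x + t * f i x) - (h y + t * f i y) =
    (f i x - f i y) * t + (h x - h y) by ring.
  by ring.
apply: psdZ; first exact: gauss_ge0.
apply: (IH (fun x => h x + t * f i x)) => x.
by rewrite (le_trans (ler_normD _ _))// lerD// normrM ler_wpM2l.
Qed.

Lemma absmean_gt0 : 0 < absmean 1 0 :> R.
Proof.
pose m : R := gauss 2; have m0 : 0 < m.
  rewrite /m /gauss normal_pdfE ?oner_eq0// mulr_gt0 ?expR_gt0//.
  by rewrite normal_peak_gt0// oner_eq0.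
suff : (m%:E <= (absmean 1 0)%:E)%E by rewrite lee_fin; exact: lt_le_trans.
rewrite -absmeanE.
have mf : measurable_fun [set: R] (fun u : R => (`|1 * u + 0| * gauss u)%:E).
  by have /measurable_int := @integrable_absint R 1 0.
have f0 (u : R) : (0 <= (`|1 * u + 0| * gauss u)%:E)%E.
  by rewrite lee_fin mulr_ge0// gauss_ge0.
apply: (@le_trans _ _ (\int[mu]_(u in `[1%R, 2%R]) (`|1 * u + 0| * gauss u)%:E)%E); last first.
  by apply: ge0_subset_integral.
apply: (@le_trans _ _ (\int[mu]_(u in `[1%R, 2%R]) m%:E)%E).
  rewrite integral_cst//= lebesgue_measure_itv/= lte_fin ltr1n.
  by rewrite -EFinB -EFinM lee_fin; lra.
apply: ge0_le_integral => //.
- by move=> u _; rewrite lee_fin ltW.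
- exact: measurable_funTS.
- move=> u; rewrite /= in_itv/= => /andP[u1 u2]; rewrite lee_fin mul1r addr0.
  rewrite ger0_norm; last by lra.
  apply: (@le_trans _ _ (1 * gauss u)); last by rewrite ler_wpM2r// gauss_ge0.
  rewrite mul1r /m /gauss !normal_pdfE ?oner_eq0//.
  rewrite ler_wpM2l ?normal_peak_ge0// ler_expR !subr0 ler_wpM2r//.
  by rewrite lerN2 ler_sqr ?nnegrE; lra.
Qed.

Lemma absmean_homo a : 0 <= a -> absmean a 0 = a * absmean 1 0 :> R.
Proof.
move=> a0; rewrite /absmean -RintegralZl//; last exact: integrable_absint.
by apply: eq_Rintegral => u _; rewrite !addr0 mul1r normrM (ger0_norm a0) mulrA.
Qed.

(** The Euclidean norm is a multiple of the mean of [`|<x, u>|] over a standard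
normal vector [u], and each [`|<x, u>|] is a distance on a bounded interval. *)
Lemma psd_subr_l2dist (I : Type) (s : seq I) (f : I -> T -> R) b :
  (forall i x, `|f i x| <= b) ->
  exists c, psd (fun x y => c - Num.sqrt (\sum_(i <- s) (f i x - f i y) ^+ 2)).
Proof.
move=> /(psd_subr_absmean s)[c pc]; have M0 := absmean_gt0.
have /pc : forall x : T, `|0 : R| <= 0 by move=> x; rewrite normr0.
move=> {}pc; exists ((absmean 1 0)^-1 * c).
apply: psd_ext (psdZ (_ : 0 <= (absmean 1 0)^-1) pc); last by rewrite invr_ge0 ltW.
move=> x y; rewrite /= mulr0 addr0 subr0 (absmean_homo (a := Num.sqrt _)) ?sqrtr_ge0//.
by rewrite mulrBr; congr (_ - _); rewrite mulrC mulfK// gt_eqF.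
Qed.

End EuclideanPsd.

(** * Discretisation of signed measures *)

Section FiniteMeasure.
Context d (U : measurableType d) (R : realType).
Context (P : {finite_measure set U -> \bar R}).

Lemma integrable_bounded (f : U -> R) b : measurable_fun setT f ->
  (forall x, `|f x| <= b) -> P.-integrable setT (EFin \o f).
Proof.
move=> mf fb; apply: measurable_bounded_integrable => //.
  by rewrite ltey_eq fin_num_measure.
exists b; split; first exact: num_real.
by move=> M bM x _; apply: le_trans (fb x) _; exact: ltW.
Qed.

Lemma le_Rintegral_dist (f g : U -> R) b eta : measurable_fun setT f ->
  measurable_fun setT g -> (forall x, `|f x| <= b) -> (forall x, `|g x| <= b) ->
  (forall x, `|f x - g x| <= eta) ->
  `|\int[P]_x f x - \int[P]_x g x| <= eta * fine (P setT).
Proof.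
move=> mf mg fb gb fg.
have intf := integrable_bounded mf fb; have intg := integrable_bounded mg gb.
rewrite -RintegralB//; apply: le_trans (le_normr_Rintegral measurableT _) _.
  exact: (integrableB measurableT intf intg).
rewrite -Rintegral_cst//; apply: le_Rintegral => //.
- apply: (integrable_bounded (b := eta)) => [|x]; last by rewrite normr_id.
  by apply: measurableT_comp => //; exact: measurable_funB.
- exact: (integrable_bounded (b := `|eta|)).
Qed.

(** The sum is the integral of the step function [v \o k], which is uniformly
close to [f]. *)
Lemma Rintegral_discretise (k : U -> nat) m (v : nat -> R) (f : U -> R) b eta :
  (forall i, measurable [set x | k x = i]) -> (forall x, (k x < m)%N) ->
  measurable_fun setT f -> (forall x, `|f x| <= b) ->
  (forall x, `|f x - v (k x)| <= eta) ->
  `|\int[P]_x f x - \sum_(i < m) fine (P [set x | k x = i]) * v i| <=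
  eta * fine (P setT).
Proof.
move=> mk km mf fb fv.
pose B i := [set x | k x = i].
have mB i : measurable_fun setT (fun x => v i * \1_(B i) x).
  apply: measurable_funM; first exact: measurable_cst.
  by apply: measurable_indic; exact: mk.
have iB (i : 'I_m) : P.-integrable setT (EFin \o (fun x => v i * \1_(B i) x)).
  apply: (integrable_bounded (b := `|v i|)) => // x.
  by rewrite normrM ler_piMr// normr_nat lern1 leq_b1.
have gE x : \sum_(i < m) v i * \1_(B i) x = v (k x).
  rewrite (bigD1 (Ordinal (km x)))//= big1 ?addr0 => [|i /eqP ik].
    by rewrite indicE mem_set// mulr1.
  rewrite indicE memNset ?mulr0// => /= kx.
  by apply: ik; apply: val_inj.
have -> : \sum_(i < m) fine (P (B i)) * v i = \int[P]_x v (k x).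
  under [RHS]eq_Rintegral do rewrite -gE.
  rewrite (Rintegral_bigsum _ _ iB).1//; apply: eq_bigr => i _.
  rewrite RintegralZl//.
    rewrite /Rintegral integral_indic; [by rewrite setIT mulrC|by []|exact: mk].
  apply: (integrable_bounded (b := 1)); first by apply: measurable_indic; exact: mk.
  by move=> x; rewrite normr_nat lern1 leq_b1.
have vb x : `|v (k x)| <= b + eta.
  have -> : v (k x) = f x - (f x - v (k x)) by ring.
  by rewrite (le_trans (ler_normB _ _))// lerD.
have eta0 (x : U) : 0 <= eta by exact: le_trans (normr_ge0 _) (fv x).
apply: (le_Rintegral_dist (b := b + eta)) => //.
- rewrite (_ : (fun x => v (k x)) = (fun x => \sum_(i < m) v i * \1_(B i) x)).
    by apply: measurable_sum.
  by apply/funext => x; rewrite gE.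
- by move=> x; rewrite (le_trans (fb x))// lerDl (eta0 x).
Qed.

End FiniteMeasure.

Section SignedMeasure.
Context d (U : measurableType d) (R : realType).
Context (mu : {charge set U -> \bar R}).

Let P := jordan_pos (hahn_pos_neg mu).
Let N := jordan_neg (hahn_pos_neg mu).

Definition total_variation : R := fine (P setT) + fine (N setT).

Lemma total_variation_ge0 : 0 <= total_variation.
Proof. by rewrite addr_ge0// fine_ge0. Qed.

Lemma fine_charge (A : set U) : measurable A ->
  fine (mu A) = fine (P A) - fine (N A).
Proof.
move=> mA; rewrite (jordan_decomp (hahn_pos_neg mu) mA).
rewrite /cadd /= /cscale mulN1e fineB//; exact: fin_num_measure.
Qed.

Lemma le_signed_integral_dist (f g : U -> R) b eta : measurable_fun setT f ->
  measurable_fun setT g -> (forall x, `|f x| <= b) -> (forall x, `|g x| <= b) ->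
  (forall x, `|f x - g x| <= eta) ->
  `|signed_integral mu f - signed_integral mu g| <= eta * total_variation.
Proof.
move=> mf mg fb gb fg; rewrite /signed_integral opprD addrACA -opprD mulrDr.
apply: le_trans (ler_normB _ _) _; apply: lerD.
- exact: (le_Rintegral_dist P mf mg fb gb fg).
- exact: (le_Rintegral_dist N mf mg fb gb fg).
Qed.

Lemma signed_integral_discretise (k : U -> nat) m (v : nat -> R) (f : U -> R) b eta :
  (forall i, measurable [set x | k x = i]) -> (forall x, (k x < m)%N) ->
  measurable_fun setT f -> (forall x, `|f x| <= b) ->
  (forall x, `|f x - v (k x)| <= eta) ->
  `|signed_integral mu f - \sum_(i < m) fine (mu [set x | k x = i]) * v i| <=
  eta * total_variation.
Proof.
move=> mk km mf fb fv; rewrite /signed_integral.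
under eq_bigr do rewrite fine_charge// mulrBl.
rewrite sumrB opprD addrACA -opprD mulrDr.
apply: le_trans (ler_normB _ _) _; apply: lerD.
- exact: (Rintegral_discretise P mk km mf fb fv).
- exact: (Rintegral_discretise N mk km mf fb fv).
Qed.

Lemma charge_discretise (k : U -> nat) m :
  (forall i, measurable [set x | k x = i]) -> (forall x, (k x < m)%N) ->
  fine (mu setT) = \sum_(i < m) fine (mu [set x | k x = i]).
Proof.
move=> mk km; have := @signed_integral_discretise k m (fun=> 1) (fun=> 1) 1 0 mk km.
move=> /(_ (measurable_cst _)) H.
have H1 (x : U) : `|1 : R| <= 1 by rewrite normr1.
have H2 (x : U) : `|1 - 1 : R| <= 0 by rewrite subrr normr0.
have := H H1 H2; rewrite mul0r normr_le0 subr_eq0 => /eqP.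
under eq_bigr do rewrite mulr1.
by move=> <-; rewrite fine_charge// /signed_integral !Rintegral_cst// !mul1r.
Qed.

End SignedMeasure.

Section Energy.
Context (R : realType) (X : pmetricType R).
Notation borel := (g_sigma_algebraType (@open X)).
Implicit Types (mu : signed_borel_measure X) (x y : X).

Lemma open_borel (A : set X) : open A -> measurable (A : set borel).
Proof. exact: sub_sigma_algebra. Qed.

Lemma ball_borel x e : measurable ([set y | mdist x y < e] : set borel).
Proof.
apply: open_borel; rewrite openE => y /= xy; apply/nbhs_ballP.
exists (e - mdist x y); first by rewrite /= subr_gt0.
move=> z; rewrite ballEmdist /= ltrBrDl; apply: le_lt_trans.
exact: metric_triangle.
Qed.

Lemma lipschitz_borel (f : X -> R) C :
  (forall x y, `|f x - f y| <= C * mdist x y) ->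
  measurable_fun [set: borel] (f : borel -> R).
Proof.
move=> fC; apply: (measurability _ (RGenOpens.measurableE R)).
move=> _ [_ [a [b ->] <-]]; rewrite setTI.
apply: open_borel; rewrite openE => x /=; rewrite in_itv/= => /andP[afx fxb].
pose D := `|C| + 1; have D0 : 0 < D by rewrite ltr_pwDr.
pose e := Num.min (f x - a) (b - f x); have e0 : 0 < e.
  by rewrite lt_min !subr_gt0 afx.
apply/nbhs_ballP; exists (e / D); first by rewrite /= divr_gt0.
move=> y; rewrite ballEmdist /= ltr_pdivlMr// => xy.
have : `|f x - f y| < e.
  apply: le_lt_trans (fC x y) _; apply: le_lt_trans xy.
  rewrite mulrC ler_wpM2l ?mdist_ge0// (le_trans (ler_norm _))//.
  by rewrite lerDl.
rewrite lt_min !ltr_norml in_itv/= => /andP[/andP[h1 h2] /andP[h3 h4]].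
by apply/andP; split; lra.
Qed.

(** The cells refine a cover by balls into a partition: a point belongs to the
first ball of the list that contains it. *)
Definition cell (s : seq X) (del : R) (x : X) : nat :=
  find (fun y => mdist y x < del) s.

Lemma cell_borel s del i : measurable ([set x | cell s del x = i] : set borel).
Proof.
elim: s i => [|y s IH] i.
  rewrite /cell/=; case: i => [|i].
    by rewrite (_ : [set _ | _] = setT)//; apply/seteqP.
  by rewrite (_ : [set _ | _] = set0)//; apply/seteqP; split=> x.
case: i => [|i].
  rewrite (_ : [set x | _] = [set x | mdist y x < del]); first exact: ball_borel.
  by apply/seteqP; split=> x /=; rewrite /cell/=; case: ifP.
rewrite (_ : [set x | _] =
  ~` [set x | mdist y x < del] `&` [set x | cell s del x = i]).
  by apply: measurableI => //; apply: measurableC; exact: ball_borel.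
apply/seteqP; split=> x /=; rewrite /cell/=; case: ifP => //= h.
- by move=> [<-]; split=> //; rewrite h.
- by move=> [].
- by move=> [_ ->].
Qed.

(** [expR (- t)] is 1-Lipschitz for nonnegative [t]. *)
Lemma expRN_mdist_dist x x' y :
  `|expR (- mdist x y) - expR (- mdist x' y)| <= mdist x x'.
Proof.
wlog h : x x' / mdist x y <= mdist x' y => [H|].
  have [h|/ltW h] := leP (mdist x y) (mdist x' y); first exact: H.
  by rewrite distrC (metric_sym x x'); exact: H.
rewrite ger0_norm ?subr_ge0 ?ler_expR ?lerN2//.
have -> : expR (- mdist x' y) = expR (- mdist x y) * expR (- (mdist x' y - mdist x y)).
  by rewrite -expRD; congr expR; ring.
rewrite -[X in X - _]mulr1 -mulrBr.
apply: (@le_trans _ _ (1 * (mdist x' y - mdist x y))).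
  apply: ler_pM; rewrite ?expR_ge0//.
  - by rewrite subr_ge0 -expR0 ler_expR oppr_le0 subr_ge0.
  - by rewrite -expR0 ler_expR oppr_le0 mdist_ge0.
  - have := expR_ge1Dx (- (mdist x' y - mdist x y)); lra.
rewrite mul1r lerBlDr (metric_sym x x'); exact: metric_triangle.
Qed.

Lemma expRN_mdist_le1 x y : `|expR (- mdist x y)| <= 1.
Proof. by rewrite ger0_norm ?expR_ge0// -expR0 ler_expR oppr_le0 mdist_ge0. Qed.

(** If finitely many balls of every radius cover the space, [Zform mu mu] is
approximated by quadratic forms of the kernel [expR (- d)] at the centres, with
the masses of the cells of a partition as coefficients. *)
Lemma Zform_ge mu c : 
  (forall del, 0 < del -> exists s : seq X, forall x, exists2 y, y \in s & mdist y x < del) ->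
  psd (fun x y => expR (- mdist x y) - c) ->
  c * fine (mu setT) ^+ 2 <= Zform mu mu.
Proof.
move=> tot pK; pose V := total_variation mu.
have V0 : 0 <= V := total_variation_ge0 mu.
(* the potential of [mu], which is Lipschitz and therefore close to its value
   at the centre of each cell *)
pose G y := signed_integral mu (fun x => expR (- mdist (x : X) (y : X))).
have mE y : measurable_fun [set: borel] (fun x : borel => expR (- mdist (x : X) (y : X))).
  by apply: (@lipschitz_borel _ 1) => x x'; rewrite mul1r expRN_mdist_dist.
have GL y y' : `|G y - G y'| <= V * mdist y y'.
  rewrite mulrC; apply: (@le_signed_integral_dist _ _ _ mu _ _ 1) => // x.
  - exact: expRN_mdist_le1.
  - exact: expRN_mdist_le1.
  - by rewrite (metric_sym x) (metric_sym x); exact: expRN_mdist_dist.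
have mG : measurable_fun [set: borel] (G : borel -> R).
  exact: lipschitz_borel GL.
have Gb y : `|G y| <= V.
  have := @le_signed_integral_dist _ _ _ mu _ _ 1 1 (mE y) (measurable_cst (0 : R)).
  rewrite [in X in _ -> _ -> _ -> X]/signed_integral !Rintegral_cst// !mul0r subrr subr0 mul1r.
  apply=> x; rewrite ?subr0 ?normr0//; exact: expRN_mdist_le1.
have H del : 0 < del -> c * fine (mu setT) ^+ 2 <= Zform mu mu + 2 * del * V ^+ 2.
  move=> del0; have [s sP] := tot del del0.
  pose k := cell s del; pose m := size s.
  pose xi (i : nat) := nth point s i.
  have km x : (k x < m)%N.
    by rewrite /k /cell -has_find; apply/hasP; have [y ys yx] := sP x; exists y.
  have kxi x : mdist (xi (k x)) x < del.
    have := km x; rewrite /k /cell -has_find.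
    exact: (@nth_find _ point (fun y => mdist y x < del)).
  pose mm (i : nat) := fine (mu [set x | k x = i]).
  have G1 y : `|G y - \sum_(i < m) mm i * expR (- mdist (xi i) y)| <= del * V.
    apply: (@signed_integral_discretise _ _ _ mu k m (fun i => expR (- mdist (xi i) y)) _ 1) => //.
    - exact: cell_borel.
    - by move=> x; exact: expRN_mdist_le1.
    - move=> x; apply: le_trans (expRN_mdist_dist _ _ _) _.
      by rewrite metric_sym ltW.
  pose v j := \sum_(i < m) mm i * expR (- mdist (xi i) (xi j)).
  have GV y : `|G y - v (k y)| <= 2 * del * V.
    have -> : G y - v (k y) = (G y - G (xi (k y))) + (G (xi (k y)) - v (k y)) by ring.
    apply: le_trans (ler_normD _ _) _.
    have h1 := G1 (xi (k y)).
    have h2 : `|G y - G (xi (k y))| <= del * V.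
      apply: le_trans (GL _ _) _.
      by rewrite mulrC ler_wpM2r// metric_sym ltW.
    by apply: le_trans (lerD h2 h1) _; rewrite -mulrDl; lra.
  have : `|Zform mu mu - \sum_(j < m) mm j * v j| <= 2 * del * V * V.
    apply: (@signed_integral_discretise _ _ _ mu k m v G V) => //.
    exact: cell_borel.
  rewrite ler_norml => /andP[h1 h2].
  have : 0 <= \sum_(j < m) mm j * v j - c * fine (mu setT) ^+ 2.
    rewrite (charge_discretise mu (cell_borel s del) km).
    have := pK.2 m (fun i => xi i) (fun i => mm i).
    rewrite (_ : qform _ _ _ = \sum_(j < m) mm j * v j -
      c * (\sum_(i < m) mm i) ^+ 2)//.
    rewrite /qform expr2 mulr_suml mulr_sumr -sumrB; apply: eq_bigr => i _.
    rewrite !mulr_sumr -sumrB; apply: eq_bigr => j _.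
    by rewrite (metric_sym (xi i)); ring.
  rewrite subr_ge0 expr2; lra.
apply/ler_addgt0Pr => e e0.
have D0 : 0 < 2 * (V ^+ 2 + 1) by rewrite mulr_gt0// ltr_wpDl// sqr_ge0.
apply: le_trans (H (e / (2 * (V ^+ 2 + 1))) (divr_gt0 e0 D0)) _.
have V1 : 0 < V ^+ 2 + 1 by rewrite ltr_wpDl// sqr_ge0.
rewrite lerD2l.
have -> : 2 * (e / (2 * (V ^+ 2 + 1))) * V ^+ 2 = e * (V ^+ 2 / (V ^+ 2 + 1)).
  by field; rewrite gt_eqF.
by rewrite ler_piMr ?(ltW e0)// ler_pdivrMr// mul1r lerDl.
Qed.

End Energy.

Lemma magnitude_lty (R : realType) (X : pmetricType R) (c : R) : 0 < c ->
  (forall del, 0 < del -> exists s : seq X,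
     forall x, exists2 y, y \in s & mdist y x < del) ->
  psd (fun x y : X => expR (- mdist x y) - c) -> (magnitude X < +oo)%E.
Proof.
move=> c0 tot pK; apply: (@le_lt_trans _ _ (c^-1)%:E); last by rewrite ltry.
apply: ge_ereal_sup => _ [mu /= Z0 <-]; rewrite lee_fin.
have Zc := Zform_ge mu tot pK.
have Zp : 0 < Zform mu mu.
  rewrite lt_neqAle eq_sym Z0 (le_trans _ Zc)// mulr_ge0 ?sqr_ge0//.
  exact: ltW.
by rewrite ler_pdivrMr// mulrC ler_pdivlMr// mulrC.
Qed.

(** * The spaces (l_p^n)^a *)

Section LpKernel.
Context (R : realType) (n : nat) (p a : R).
Hypotheses (p0 : 0 < p) (p2 : p <= 2) (a0 : 0 < a) (a1 : a <= 1).

Lemma lpdist_powR (x y : 'rV[R]_n) : lpdist p a x y =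
  (\sum_j `|x 0 j - y 0 j| `^ p) `^ (p^-1 * (a * Num.min 1 p)).
Proof.
rewrite /lpdist /lpnorm -powRrM.
by under eq_bigr do rewrite !mxE.
Qed.

Lemma lp_exponent : 0 < p^-1 * (a * Num.min 1 p) <= 1.
Proof.
have m0 : 0 < Num.min 1 p by rewrite lt_min ltr01.
rewrite mulr_gt0 ?invr_gt0 ?mulr_gt0//= mulrC ler_pdivrMr// mul1r.
apply: (@le_trans _ _ (1 * Num.min 1 p)); first by rewrite ler_wpM2r// ltW.
by rewrite mul1r ge_min lexx orbT.
Qed.

Lemma norm_coord_le_lpdist (x y : 'rV[R]_n) j :
  `|x 0 j - y 0 j| `^ (a * Num.min 1 p) <= lpdist p a x y.
Proof.
have /andP[e0 _] := lp_exponent.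
rewrite lpdist_powR -[X in _ `^ X <= _](mulKf (lt0r_neq0 p0)) mulrCA powRrM.
rewrite ge0_ler_powR ?nnegrE ?powR_ge0 ?(ltW e0)//.
  by apply: sumr_ge0 => i _; exact: powR_ge0.
rewrite (bigD1 j)//= lerDl; apply: sumr_ge0 => i _; exact: powR_ge0.
Qed.

(** Sums of kernels take care of [p < 2]; for [p = 2] no constant dominates
[`|x j - y j| ^+ 2] and the Euclidean norm itself is the base. *)
Lemma psd_subr_lpdist (T : Type) (f : T -> 'rV[R]_n) b :
  (forall x j, `|f x 0 j| <= b) ->
  exists c, psd (fun x y => c - lpdist p a (f x) (f y)).
Proof.
move=> fb; have [p22|p2'] := eqVneq p 2.
  have [c pc] := psd_subr_l2dist (index_enum 'I_n) (f := fun j x => f x 0 j)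
    (fun j x => fb x j).
  exists ((2 * c) `^ a).
  apply: psd_ext (psd_subr_powR (s := fun x y =>
    Num.sqrt (\sum_j (f x 0 j - f y 0 j) ^+ 2)) (g := a) _ _ pc _).
  - move=> x y; congr (_ - _); rewrite lpdist_powR p22 -powR12_sqrt; last first.
      by apply: sumr_ge0 => j _; exact: sqr_ge0.
    rewrite min_l ?ler1n// mulr1 powRrM; congr ((_ `^ _) `^ _).
    apply: eq_bigr => j _.
    by rewrite (powR_mulrn 2)// real_normK// num_real.
  - by move=> x y; exact: sqrtr_ge0.
  - by move=> x; rewrite big1 ?sqrtr0// => j _; rewrite subrr expr0n.
  - by rewrite a0.
have p02 : 0 < p < 2 by rewrite p0 lt_neqAle p2'.
have /fin_all_exists[c pc] (j : 'I_n) : 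
    exists c, psd (fun x y => c - `|f x 0 j - f y 0 j| `^ p).
  exact: psd_subr_dist_powR (fun x => fb x j) p02.
exists ((2 * \sum_j c j) `^ (p^-1 * (a * Num.min 1 p))).
apply: psd_ext (psd_subr_powR (s := fun x y =>
    \sum_j `|f x 0 j - f y 0 j| `^ p) (c := \sum_j c j) _ _ _ lp_exponent).
- by move=> x y; rewrite lpdist_powR.
- by move=> x y; apply: sumr_ge0 => j _; exact: powR_ge0.
- move=> x; rewrite big1// => j _; rewrite subrr normr0 powR0//.
  exact: lt0r_neq0.
- apply: (@psd_ext _ _ (fun x y => \sum_j (c j - `|f x 0 j - f y 0 j| `^ p))).
    by move=> x y; rewrite sumrB.
  exact: psd_sum.
Qed.

Lemma psd_expRN_lpdist (T : Type) (f : T -> 'rV[R]_n) b :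
  (forall x j, `|f x 0 j| <= b) ->
  exists2 c, 0 < c & psd (fun x y => expR (- lpdist p a (f x) (f y)) - c).
Proof.
move=> /psd_subr_lpdist[c pc]; exists (expR (- c)); first exact: expR_gt0.
apply: psd_ext (psdZ (expR_ge0 (- c)) (psd_expR_sub1 pc)) => x y /=.
by rewrite mulrBr mulr1 -expRD addKr.
Qed.

End LpKernel.

Lemma metric_subspace_finite_cover (R : realType) (X : metricType R) (A : set X)
    (A0 : A !=set0) : compact A -> forall del : R, 0 < del ->
  exists s : seq (metric_subspace A0),
    forall x, exists2 y, y \in s & mdist y x < del.
Proof.
move=> cA del del0; pose S : choiceType := metric_subspace A0.
(* finite families of centres ordered by inclusion: covering compactness for
   this filter yields one family that serves all points of [A] *)
pose F : set_system (seq S) :=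
  [set Q | exists s0 : seq S, forall s : seq S, {subset s0 <= s} -> Q s].
have FF : Filter F.
  split=> [|Q Q' [s sQ] [s' sQ']|Q Q' QQ' [s sQ]].
  - by exists [::].
  - exists (s ++ s') => r sr; split.
      by apply: sQ => y ys; apply: sr; rewrite mem_cat ys.
    by apply: sQ' => y ys; apply: sr; rewrite mem_cat ys orbT.
  - by exists s => r sr; exact: QQ' (sQ r sr).
have [|s /(_ s (fun _ => id)) sA] := (compact_near_coveringP A).1 cA (seq S) F
  (fun s x => exists2 y : S, y \in s & mdist (set_val y) x < del) FF.
  move=> x Ax; exists (ball x del, [set s : seq S | (exist _ x (mem_set Ax) : S) \in s]).
    split; first exact: nbhsx_ballx.
    by exists [:: exist _ x (mem_set Ax) : S] => s /=; apply; rewrite mem_head.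
  move=> [x' s] /= []; rewrite ballEmdist => xx' xs.
  by exists (exist _ x (mem_set Ax)).
by exists s => x; apply: sA; exact: set_valP.
Qed.

Unset Implicit Arguments.

Theorem theorem4p3 (R : realType) (n : nat) (n0 : (0 < n)%N) (p a : R)
  (p0 : 0 < p) (p2 : p <= 2) (a0 : 0 < a) (a1 : a <= 1)
  (A : set (lpspace n p0 a0 a1)) (A0 : A !=set0) (cA : compact A) :
  (magnitude (metric_subspace A0) < +oo)%E.
Proof.
have tot := metric_subspace_finite_cover A0 cA.
pose f (x : metric_subspace A0) : 'rV[R]_n := set_val x.
have [b fb] : exists b, forall x j, `|f x 0 j| <= b.
  (* finitely many balls of radius 1 cover [A], and in each ball the
     coordinates differ by at most 1 *)
  have [s sP] := tot 1 ltr01.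
  exists (1 + \sum_(y <- s) \sum_j `|f y 0 j|) => x j.
  have [y ys yx] := sP x.
  have yxj : `|f y 0 j - f x 0 j| <= 1.
    rewrite leNgt; apply/negP => h.
    suff : 1 <= lpdist p a (f y) (f x) by rewrite leNgt yx.
    apply: le_trans (norm_coord_le_lpdist p0 a0 a1 _ _ j).
    rewrite -[leLHS](powRr0 `|f y 0 j - f x 0 j|) ler_powR ?(ltW h)//.
    by rewrite mulr_ge0 ?(ltW a0)// ltW// lt_min ltr01.
  have fy : `|f y 0 j| <= \sum_(y <- s) \sum_j `|f y 0 j|.
    apply: (@le_trans _ _ (\sum_j `|f y 0 j|)).
      by rewrite (bigD1 j)//= lerDl sumr_ge0.
    rewrite (big_rem y)//= lerDl; apply: sumr_ge0 => z _; exact: sumr_ge0.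
  have -> : f x 0 j = f y 0 j - (f y 0 j - f x 0 j) by ring.
  apply: le_trans (ler_normB _ _) _; rewrite addrC; exact: lerD.
have [c c0 pc] := psd_expRN_lpdist p0 p2 a0 a1 fb.
exact: magnitude_lty c0 tot pc.
Qed.
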